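(* Let $n\ge 1$ and let $\alpha\vdash n$ be a partition of $n$. Let $b_\alpha$ be the corresponding element of the norm basis of the centre of the Iwahori--Hecke algebra $\mathcal H_n$ of $S_n$, and let $\Gamma_\lambda$ ($\lambda\vdash n$) be the class elements (minimal basis). Then $$b_\alpha=\sum_{\lambda\vdash n}(1_{S_\lambda})^{S_n}(w_\alpha)\,\xi^{\,l_\lambda-l_\alpha}\,\Gamma_\lambda .$$
   Context: $S_n$ is the symmetric group with simple reflections $s_i=(i\ \ i+1)$, $1\le i\le n-1$, and length function $\ell$. The Iwahori--Hecke algebra $\mathcal H=\mathcal H_n$ is the associative $\mathbb Z[\xi]$-algebra ($\xi$ an indeterminate) with identity $\tilde T_1$, generated by $\tilde T_{s_1},\dots,\tilde T_{s_{n-1}}$ subject to the braid relations $\tilde T_{s_i}\tilde T_{s_j}=\tilde T_{s_j}\tilde T_{s_i}$ for $|i-j|\ge 2$, $\tilde T_{s_i}\tilde T_{s_{i+1}}\tilde T_{s_i}=\tilde T_{s_{i+1}}\tilde T_{s_i}\tilde T_{s_{i+1}}$, and $\tilde T_{s_i}^2=\tilde T_1+\xi\tilde T_{s_i}$. For a reduced expression $w=s_{i_1}\cdots s_{i_r}$ put $\tilde T_w=\tilde T_{s_{i_1}}\cdots\tilde T_{s_{i_r}}$; the $\tilde T_w$, $w\in S_n$, form a $\mathbb Z[\xi]$-basis. $Z(\mathcal H)$ is the centre. Specialization at $\xi=0$ gives the group algebra $\mathbb Z S_n$. A composition $\lambda=(\lambda_1,\dots,\lambda_r)$ of $n$ (written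 $\lambda\vDash n$) is a finite sequence of positive integers with sum $n$; it is a partition ($\lambda\vdash n$) if it is weakly decreasing. $S_\lambda=S_{\lambda_1}\times\cdots\times S_{\lambda_r}\le S_n$ is the standard parabolic subgroup, with $i$-th factor generated by $s_{\lambda_1+\dots+\lambda_{i-1}+1},\dots,s_{\lambda_1+\dots+\lambda_i-1}$ (trivial if $\lambda_i=1$). $\lambda-1$ denotes the composition obtained from $\lambda$ by replacing each $\lambda_i>1$ by the two consecutive entries $\lambda_i-1,1$. The element $w_\lambda\in S_\lambda$ is the product over $i=1,\dots,r$ of $s_{\lambda_1+\dots+\lambda_{i-1}+1}\,s_{\lambda_1+\dots+\lambda_{i-1}+2}\cdots s_{\lambda_1+\dots+\lambda_i-1}$ (empty product if $\lambda_i=1$), and $l_\lambda=\ell(w_\lambda)$. For $\lambda\vdash n$, $C_\lambda$ is the conjugacy class of $S_n$ of elements of cycle type $\lambda$; $w_\lambda$ is an element of $C_\lambda$ of minimal length. For standard parabolic subgroups $S_\mu\le S_\lambda$ and $h\in\mathcal H$, the relative norm is $\mathcal N_{S_\lambda,S_\mu}(h)=\sum_{d}\tilde T_{d^{-1}}h\tilde T_d$, the sum over the distinguished (minimal length) representatives $d$ of the right cosets $S_\mu d$ of $S_\mu$ in $S_\lambda$. Put $\eta_\lambda=\mathcal N_{S_{\lambda-1},1}(\tilde T_{w_\lambda})$ and $b_\alpha=\mathcal N_{S_n,S_\alpha}(\eta_\alpha)$. The set $\{b_\alpha\mid\alpha\vdash n\}$ is the norm basis ($b_\alpha\in Z(\mathcal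 H)$; it is a basis of the centre over $\mathbb Q[\xi]$). The class elements $\{\Gamma_\lambda\mid\lambda\vdash n\}$ are the elements of $Z(\mathcal H)$ characterized (Geck--Rouquier) by: $\Gamma_\lambda|_{\xi=0}=\sum_{w\in C_\lambda}w$, and in $\Gamma_\lambda-\sum_{w\in C_\lambda}\tilde T_w$ the coefficient of $\tilde T_w$ is zero whenever $w$ has minimal length in its conjugacy class. They form a $\mathbb Z[\xi]$-basis of $Z(\mathcal H)$. $(1_{S_\lambda})^{S_n}$ is the permutation character of $S_n$ induced from the trivial character of $S_\lambda$. If $l_\lambda<l_\alpha$, the character value $(1_{S_\lambda})^{S_n}(w_\alpha)$ is $0$, and the corresponding term is read as $0$ (equivalently, the formula is read over $\mathbb Z[\xi,\xi^{-1}]$). *)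

(* Defs.v *)
From HB Require Import structures.
From mathcomp Require Import all_boot all_order all_algebra all_fingroup.
From mathcomp Require Import all_field all_character.

Set Implicit Arguments.
Unset Strict Implicit.
Unset Printing Implicit Defensive.

Import Order.TTheory GRing.Theory Num.Theory GroupScope.

Local Open Scope nat_scope.

(* Points and simple reflections are numbered from 0: for i : 'I_n.-1,
   srefl i exchanges i and i.+1. *)
Lemma srefl_subproof n (i : 'I_n.-1) : i.+1 < n.
Proof. by rewrite -ltn_predRL ltn_ord. Qed.

Definition srefl n (i : 'I_n.-1) : 'S_n :=
  tperm (widen_ord (leq_pred n) i) (Ordinal (srefl_subproof i)).

(* Products in 'S_n are composed from left to right.  Below, the group is only
   accessed through words in the simple reflections, so the opposite convention
   would give the same objects up to the isomorphism fixing every srefl i. *)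
Definition is_word n (w : 'S_n) (r : seq 'I_n.-1) : bool :=
  w == (\prod_(i <- r) srefl i)%g.

Lemma srefl_gen n (w : 'S_n) : w \in <<[set srefl i | i : 'I_n.-1]>>%g.
Proof.
pose G := <<[set srefl i | i : 'I_n.-1]>>%G; change (w \in G).
have adj (a b : 'I_n) : b = a.+1 :> nat -> tperm a b \in G.
  move=> ab; have ha : a < n.-1 by rewrite ltn_predRL -ab ltn_ord.
  apply: mem_gen; apply/imsetP; exists (Ordinal ha) => //.
  by rewrite /srefl; congr tperm; apply: val_inj.
have dist k : forall a b : 'I_n, b = a + k.+1 :> nat -> tperm a b \in G.
  elim: k => [|k IHk] a b ab; first by apply: adj; rewrite ab addn1.
  have hc : a + k.+1 < n by apply: ltn_trans (ltn_ord b); rewrite ab !addnS.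
  pose c := Ordinal hc.
  have -> : tperm a b = (tperm a c ^ tperm c b)%g.
    rewrite tpermJ tpermL tpermD // -val_eqE /= ?ab ?addnS.
      by rewrite gtn_eqF // ltnS leq_addr.
    by rewrite gtn_eqF // ltnS -addnS leq_addr.
  by apply: groupJ; [apply: IHk | apply: adj; rewrite ab /= !addnS].
have [ts -> /= _] := prod_tpermP w; apply: group_prod => -[a b] /= _.
case: (ltngtP a b) => [lab|lba|/val_inj->]; last by rewrite tperm1 group1.
  by apply: (dist (b - a.+1)); rewrite addnS -addSn subnKC.
by rewrite tpermC; apply: (dist (a - b.+1)); rewrite addnS -addSn subnKC.
Qed.

Lemma word_exists n (w : 'S_n) :
  exists k, [exists r : k.-tuple 'I_n.-1, is_word w r].
Proof.
have [k [c cS ->]] := gen_prodgP (srefl_gen w).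
have {}cS (i : 'I_k) : exists j, c i == srefl j.
  by have /imsetP[j _ ->] := cS i; exists j.
pose f i := xchoose (cS i).
exists k; apply/existsP; exists [tuple f i | i < k].
rewrite /is_word big_tuple; apply/eqP; apply: eq_bigr => i _.
by rewrite tnth_mktuple; apply/eqP; apply: (xchooseP (cS i)).
Qed.

Definition len n (w : 'S_n) : nat := ex_minn (word_exists w).

Lemma reduced_word_exists n (w : 'S_n) :
  exists r, is_word w r && (size r == len w).
Proof.
rewrite /len; case: ex_minnP => k /existsP[r wr] _.
by exists r; rewrite wr size_tuple eqxx.
Qed.

Definition reduced_word n (w : 'S_n) : seq 'I_n.-1 :=
  xchoose (reduced_word_exists w).

Definition min_in_class n (w : 'S_n) : bool :=
  [forall v in w ^: [set: 'S_n], len w <= len v].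

Definition is_partition n (la : seq nat) : bool :=
  [&& all (leq 1) la, sumn la == n & sorted geq la].

(* The partitions of n as a finite type: they have at most n parts, and no part
   exceeds n. *)
Record intpart n := IntPart {
  intpart_val : n.-bseq 'I_n.+1;
  _ : is_partition n (map val intpart_val) }.

HB.instance Definition _ n := [isSub for @intpart_val n].
HB.instance Definition _ n := [Finite of intpart n by <:].

Definition parts n (la : intpart n) : seq nat := map val (intpart_val la).
Coercion parts : intpart >-> seq.

Lemma intpart_surj n (s : seq nat) :
  is_partition n s -> exists la : intpart n, parts la = s.
Proof.
move=> hs; have /and3P[pos /eqP sums _] := hs.
have le_n x : x \in s -> x < n.+1.
  move=> xs; rewrite ltnS -sums.
  elim: s xs {hs pos sums} => //= y s IHs; rewrite inE => /predU1P[->|/IHs].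
    exact: leq_addr.
  by move/leq_trans; apply; apply: leq_addl.
have sz : size s <= n.
  rewrite -sums; elim: s pos {hs sums le_n} => //= y s IHs /andP[y0 /IHs h].
  by rewrite -add1n leq_add.
pose t : seq 'I_n.+1 := map inord s.
have szt : size t <= n by rewrite size_map.
have tE : map val t = s.
  by rewrite -map_comp -[RHS]map_id; apply/eq_in_map => x /le_n /inordK.
have ht : is_partition n (map val (Bseq szt)) by rewrite tE.
by exists (IntPart ht).
Qed.

(* comp_minus1 la is the composition written la - 1. *)
Definition comp_minus1 (la : seq nat) : seq nat :=
  flatten [seq if 1 < a then [:: a.-1; 1] else [:: a] | a <- la].

(* With offset 0, the indices of the simple reflections of the parabolic
   subgroup of the composition la, block by block and increasing. *)
Fixpoint block_word (off : nat) (la : seq nat) : seq nat :=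
  if la is a :: la' then iota off a.-1 ++ block_word (off + a) la' else [::].

(* For a composition la of n every index is in range, so that the conversion
   to 'I_n.-1 discards nothing, see comp_wordE. *)
Definition comp_word n (la : seq nat) : seq 'I_n.-1 :=
  pmap insub (block_word 0 la).

Lemma comp_wordE n (la : seq nat) :
  all (leq 1) la -> sumn la = n -> map val (comp_word n la) = block_word 0 la.
Proof.
move=> pos sumla; rewrite /comp_word pmap_filter; last exact: insubK.
apply/all_filterP; apply/allP => x xla; rewrite isSome_insub ltn_predRL.
suff bound off : x \in block_word off la -> x.+1 < off + sumn la.
  by rewrite -sumla; apply: (bound 0).
elim: la off pos {sumla xla} => //= a la IHla off /andP[a0 pos].
rewrite mem_cat mem_iota addnA => /orP[/andP[_ hx]|]; last exact: IHla.
by rewrite ltn_addr // -(prednK a0) addnS ltnS.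
Qed.

Definition parabolic n (la : seq nat) : {group 'S_n} :=
  <<[set srefl i | i in comp_word n la]>>%G.

Definition w_comp n (la : seq nat) : 'S_n :=
  (\prod_(i <- comp_word n la) srefl i)%g.

Definition l_comp n (la : seq nat) : nat := len (w_comp n la).

Definition cycle_type n (w : 'S_n) : seq nat :=
  sort geq [seq #|c| | c : {set 'I_n} <- enum (porbits w)].

Definition cycle_class n (la : seq nat) : {set 'S_n} :=
  [set w | cycle_type w == la].

(* Representatives of minimal length of the right cosets K :* d in G. *)
Definition dist_reps n (G K : {group 'S_n}) : {set 'S_n} :=
  [set d in G | [forall x in K :* d, len d <= len x]].

(* The permutation character takes its values in algC.  They are integers, so
   taking the floor only changes the type, see perm_char_valE. *)
Definition perm_char_val n (la : seq nat) (w : 'S_n) : int :=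
  Num.floor ('Ind[[set: 'S_n], parabolic n la] 1 w)%R.

Lemma perm_char_valE n (la : seq nat) (w : 'S_n) :
  ((perm_char_val la w)%:~R =
   ('Ind[[set: 'S_n], parabolic n la] 1 w)%R :> algC)%R.
Proof.
rewrite /perm_char_val; set H := parabolic n la.
suff [k ->] : exists k : nat, ('Ind[[set: 'S_n], H] 1 w)%R = (k%:R)%R :> algC.
  by rewrite -[(k%:R)%R]/((k%:Z)%:~R)%R intrKfloor.
pose f (y : 'S_n) : nat := (w ^ y^-1)%g \in H.
have fH (A : {set 'S_n}) : A \in rcosets H [set: 'S_n]%G ->
    \sum_(y in A) f y = #|H| * f (repr A).
  case/rcosetsP=> z _ ->{A}; rewrite -(card_rcoset H z) -sum_nat_const.
  have fz y : y \in H :* z -> f y = f z.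
    case/rcosetP=> h hH ->{y}.
    by rewrite /f invMg conjgM groupJr ?groupV.
  by apply: eq_bigr => y /fz ->; rewrite (fz _ (mem_repr_rcoset _ _)).
have sumf : \sum_(y in [set: 'S_n]) f y =
    #|H| * \sum_(A in rcosets H [set: 'S_n]%G) f (repr A).
  rewrite (set_partition_big _ (rcosets_partition (subsetT H))) big_distrr.
  exact: eq_bigr.
exists (\sum_(A in rcosets H [set: 'S_n]%G) f (repr A)).
rewrite cfIndE ?subsetT // (reindex_inj invg_inj).
have -> : (\sum_(y | y^-1%g \in [set: 'S_n]) (1 : 'CF(H))%CF (w ^ y^-1)%g =
    (\sum_(y in [set: 'S_n]) f y)%:R)%R.
  rewrite natr_sum; apply: eq_big => [y|y _]; first by rewrite !inE.
  by rewrite cfun1E.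
by rewrite sumf natrM mulKf // pnatr_eq0 -lt0n cardG_gt0.
Qed.

Local Open Scope ring_scope.

(* The indeterminate xi of the coefficient ring is 'X : {poly int}. *)
Record hecke_relations n (A : algType {poly int}) (t : 'I_n.-1 -> A) : Prop :=
  HeckeRelations {
    hecke_comm : forall i j : 'I_n.-1, (i.+1 < j)%N -> t i * t j = t j * t i;
    hecke_braid : forall i j : 'I_n.-1, j = i.+1 :> nat ->
      t i * t j * t i = t j * t i * t j;
    hecke_quad : forall i : 'I_n.-1, t i ^+ 2 = 1 + 'X *: t i }.

(* H with the generators t i is the algebra presented by the relations. *)
Record is_hecke_algebra n (H : algType {poly int}) (t : 'I_n.-1 -> H) : Prop :=
  IsHeckeAlgebra {
    hecke_rel : hecke_relations t;
    hecke_lift : forall (A : algType {poly int}) (a : 'I_n.-1 -> A),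
      hecke_relations a ->
      exists f : {lrmorphism H -> A}, forall i, f (t i) = a i;
    hecke_lift_unique : forall (A : algType {poly int})
        (f g : {lrmorphism H -> A}),
      (forall i, f (t i) = g (t i)) -> f =1 g }.

Section HeckeElements.

Variables (n : nat) (H : algType {poly int}) (t : 'I_n.-1 -> H).

(* By the braid relations this does not depend on the chosen reduced word. *)
Definition Tw (w : 'S_n) : H := \prod_(i <- reduced_word w) t i.

Definition rel_norm (G K : {group 'S_n}) (h : H) : H :=
  \sum_(d in dist_reps G K) Tw d^-1%g * h * Tw d.

Definition eta (la : seq nat) : H :=
  rel_norm (parabolic n (comp_minus1 la)) 1%G (Tw (w_comp n la)).

Definition norm_basis (la : seq nat) : H :=
  rel_norm [set: 'S_n]%G (parabolic n la) (eta la).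

(* c w is the coefficient of Tw w, and (c w).[0] its specialization at
   xi = 0. *)
Definition is_class_element (la : seq nat) (g : H) : Prop :=
  (forall h : H, g * h = h * g) /\
  exists c : 'S_n -> {poly int},
    [/\ g = \sum_w c w *: Tw w,
        forall w, (c w).[0] = (w \in cycle_class n la)%:R
      & forall w, min_in_class w -> c w - (w \in cycle_class n la)%:R = 0].

End HeckeElements.

(* Main.v *)
From HB Require Import structures.
Require Import Defs.
From mathcomp Require Import all_boot all_order all_algebra all_fingroup.
From mathcomp Require Import all_field all_character.
From mathcomp Require Import zify ring.

(** Let tau be the symmetrizing trace, the coefficient of the identity.  Both
    sides of the formula are central, and a central z gives a trace function
    tau (z * _).  The decomposition H_(k+1) = H_k + H_k T_k H_k shows that a
    trace function vanishing on every product of distinct generators taken in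
    increasing order is zero, so it is enough to compare both sides on these
    products, that is on the elements T_(w_beta) for compositions beta of n.

    On Gamma_lambda the value is 1 or 0 according to whether beta is a
    rearrangement of lambda, since w_beta has minimal length in its class.

    The element eta_alpha is the product of the Jucys-Murphy elements of the
    parabolic subalgebra of alpha, so it commutes with that subalgebra, and
    tau (eta_alpha * _) is dual to T_(w_alpha) among products of distinct
    generators.  Expanding the norm over the coset representatives d, only those
    d whose path under the factors of T_(w_beta) stays at d contribute; each
    step either multiplies by xi or moves a generator of the subalgebra of alpha to
    the left.  The surviving d place every block of alpha consecutively inside a
    block of beta, in decreasing order of their positions in alpha, and these
    are representatives of the cosets of S_beta fixed by w_alpha. *)

Set Implicit Arguments.
Unset Strict Implicit.
Unset Printing Implicit Defensive.

Import GRing.Theory.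
Local Open Scope nat_scope.

(** * Lengths and reduced words *)

Section Length.

Variable m : nat.
Implicit Types (w u v : 'S_m.+1) (x y : 'I_m.+1) (k : nat).

(** The algebra is given only by its presentation, so the independence of the T_w and the form tau
    have to be produced. The generators act on a free module with basis S_n by the expected
    formulas, the universal property turns this into a representation, and tau is a matrix entry of
    it.

    The trace criterion tests all compositions, whereas the class elements are indexed by
    partitions; hence the counts attached to rearranged compositions must also be shown equal.

    The decreasing order of the blocks of alpha inside a block of beta comes from the quadratic
    relation: a letter j that moves the coset of d contributes only through the term xi T_d of T_d
    T_j, and this term is present exactly when d s_j is shorter than d. The letters that stay must
    exhaust the generators of alpha, so the exponent of xi is l_beta - l_alpha for every surviving
    d. *)

Definition sref k : 'S_m.+1 := tperm (inord k) (inord k.+1).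

Lemma srefl_sref (i : 'I_m) : @srefl m.+1 i = sref i.
Proof.
by rewrite /srefl /sref; congr tperm; apply: val_inj;
  rewrite /= inordK // ltnS // ltnW.
Qed.

Lemma srefE k x : k < m ->
  sref k x = (if x == k :> nat then k.+1 else if x == k.+1 :> nat then k else x)
    :> nat.
Proof.
move=> km; have k1 : (inord k : 'I_m.+1) = k :> nat by rewrite inordK // ltnS ltnW.
have k2 : (inord k.+1 : 'I_m.+1) = k.+1 :> nat by rewrite inordK.
rewrite /sref; case: tpermP => [->|->|/eqP h1 /eqP h2].
- by rewrite k1 k2 eqxx.
- by rewrite k1 k2 eqxx gtn_eqF.
- by move: h1 h2; rewrite -!val_eqE /= k1 k2 => /negPf-> /negPf->.
Qed.

Lemma srefK k : involutive (sref k).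
Proof. exact: tpermK. Qed.

Lemma sref2 k : (sref k * sref k = 1)%g.
Proof. exact: tperm2. Qed.

Lemma srefV k : ((sref k)^-1 = sref k)%g.
Proof. exact: tpermV. Qed.

Lemma mulKsr k w : (sref k * (sref k * w) = w)%g.
Proof. by rewrite mulgA sref2 mul1g. Qed.

(** Composition is from left to right, so [sref k * w] sends x to [w (sref k x)], and this is the
    condition for left multiplication by [sref k] to raise the length. Right multiplication is
    controlled by [asc w^-1 k]. *)
Definition asc w k := w (inord k) < w (inord k.+1).

Lemma sref_l k : sref k (inord k) = inord k.+1.
Proof. exact: tpermL. Qed.

Lemma sref_r k : sref k (inord k.+1) = inord k.
Proof. exact: tpermR. Qed.

Lemma inord_neq k : k < m -> inord k != inord k.+1 :> 'I_m.+1.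
Proof.
by move=> km; rewrite -val_eqE /= !inordK // ?ltnS ?ltn_eqF // ltnW.
Qed.

Lemma asc_sref w k : k < m -> asc (sref k * w) k = ~~ asc w k.
Proof.
move=> km; rewrite /asc !permM sref_l sref_r -leqNgt [RHS]leq_eqVlt.
by rewrite val_eqE (inj_eq perm_inj) eq_sym (negPf (inord_neq km)).
Qed.

Definition invset w : {set 'I_m.+1 * 'I_m.+1} :=
  [set p : 'I_m.+1 * 'I_m.+1 | (p.1 < p.2) && (w p.2 < w p.1)].

Definition ninv w := #|invset w|.

(** Applying [sref k] to both entries of a pair matches the inversions of w with those of
    [sref k * w] other than the pair (k, k+1), which is a new one. *)
Lemma inv_asc w k : k < m -> asc w k -> ninv (sref k * w)%g = (ninv w).+1.
Proof.
move=> km aw; pose p0 : 'I_m.+1 * 'I_m.+1 := (inord k, inord k.+1).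
have p0in : p0 \in invset (sref k * w)%g.
  by rewrite inE /= !permM sref_l sref_r inordK ?inordK ?ltnS // ?leqnn //= ltnW.
rewrite /ninv (cardsD1 p0) p0in add1n; congr _.+1.
pose f (p : 'I_m.+1 * 'I_m.+1) := (sref k p.1, sref k p.2).
have finj : injective f by move=> [a b] [c d] [/perm_inj-> /perm_inj->].
rewrite -(card_imset _ finj); apply: eq_card => -[a b].
have -> : (a, b) = f (sref k a, sref k b) by rewrite /f /= !srefK.
rewrite mem_imset // !inE /= /f /= !permM !srefK.
have -> : ((sref k a, sref k b) != p0) = (a != inord k.+1) || (b != inord k).
  rewrite /p0 xpair_eqE negb_and -(inj_eq (@perm_inj _ (sref k)) a) sref_r.
  by rewrite -(inj_eq (@perm_inj _ (sref k)) b) sref_l.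
rewrite -!val_eqE /= !srefE // !inordK //; last by rewrite ltnS ltnW.
have [wab|] := boolP (w b < w a); rewrite ?andbF //.
rewrite !andbT.
have : ~~ ((a == k :> nat) && (b == k.+1 :> nat)).
  apply/negP => /andP[/eqP ak /eqP bk]; move: wab; rewrite ltnNge ltnW //.
  by move: aw; rewrite /asc -bk -ak !inord_val.
by case: (eqVneq (a : nat) k); case: (eqVneq (a : nat) k.+1);
  case: (eqVneq (b : nat) k); case: (eqVneq (b : nat) k.+1); lia.
Qed.

Lemma inv_desc w k : k < m -> ~~ asc w k -> ninv w = (ninv (sref k * w)%g).+1.
Proof.
by move=> km; rewrite -asc_sref // => /(inv_asc km); rewrite mulKsr.
Qed.

Lemma inv_leS w k : k < m -> ninv (sref k * w)%g <= (ninv w).+1.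
Proof.
move=> km; case: (boolP (asc w k)) => h; first by rewrite inv_asc.
by rewrite (inv_desc km h) ltnW.
Qed.

Lemma asc_mono w : (forall k, k < m -> asc w k) -> w = 1%g.
Proof.
move=> aw; have mono (a b : nat) : a < b -> b < m.+1 ->
    w (inord a) < w (inord b).
  elim: b => // b IHb; rewrite ltnS leq_eqVlt => /predU1P[->|ab] bm.
    exact: aw.
  by apply: ltn_trans (IHb ab (ltnW bm)) (aw _ _).
have ge (a : nat) : a < m.+1 -> a <= w (inord a).
  elim: a => // a IHa am.
  exact: leq_ltn_trans (IHa (ltnW am)) (mono _ _ (ltnSn a) am).
have le c : forall a : nat, a + c = m -> w (inord a) <= a.
  elim: c => [|c IHc] a ac; first by rewrite -ltnS -[a]addn0 ac.
  rewrite -ltnS; apply: leq_trans (mono a a.+1 _ _) (IHc _ _) => //; lia.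
apply/permP => x; rewrite perm1; apply/val_inj/eqP; rewrite eqn_leq.
have := ge x (ltn_ord x); have := le (m - x) x; rewrite inord_val => -> //.
by rewrite subnKC // -ltnS.
Qed.

Lemma inv1 : ninv 1%g = 0.
Proof.
apply/eqP; rewrite cards_eq0; apply/eqP/setP => -[a b].
by rewrite !inE !perm1 /=; apply/andP => -[h1 h2]; move: (ltn_trans h1 h2); rewrite ltnn.
Qed.

(** Only the identity has no descent. This replaces induction along reduced words; every step is an
    ascent, so that [TT_asc] applies to it. *)
Lemma perm_ind (P : 'S_m.+1 -> Prop) :
  P 1%g -> (forall w k, k < m -> asc w k -> P w -> P (sref k * w)%g) ->
  forall w, P w.
Proof.
move=> P1 PS w; have [l] := ubnP (ninv w); elim: l w => // l IHl w lw.
case: (boolP [forall k : 'I_m, asc w k]) => [/forallP aw|].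
  by rewrite (asc_mono (fun k km => aw (Ordinal km))).
rewrite negb_forall => /existsP[k nk].
rewrite -(mulKsr k w); apply: PS => //; first by rewrite asc_sref.
by apply: IHl; rewrite -ltnS -(inv_desc _ nk).
Qed.

Definition sprod (r : seq nat) : 'S_m.+1 := (\prod_(k <- r) sref k)%g.

Definition word w (r : seq nat) := (all (fun k => k < m) r) && (sprod r == w).

Lemma sprod_cons k r : sprod (k :: r) = (sref k * sprod r)%g.
Proof. by rewrite /sprod big_cons. Qed.

Lemma sprod_cat r s : sprod (r ++ s) = (sprod r * sprod s)%g.
Proof. exact: big_cat. Qed.

Lemma sprod_seq1 k : sprod [:: k] = sref k.
Proof. exact: big_seq1. Qed.

Lemma inv_word w r : word w r -> ninv w <= size r.
Proof.
case/andP => ar /eqP <-; elim: r ar => [|k r IHr] /=.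
  by rewrite /sprod big_nil inv1.
case/andP => km /IHr h; rewrite sprod_cons.
exact: leq_trans (inv_leS _ km) _.
Qed.

Lemma inv_word_exists w : exists2 r, word w r & size r = ninv w.
Proof.
elim/perm_ind: w => [|w k km aw [r /andP[ar /eqP rw] szr]].
  by exists [::]; rewrite ?inv1 // /word /sprod big_nil eqxx.
exists (k :: r); last by rewrite inv_asc //= szr.
by rewrite /word /= km ar sprod_cons rw /= eqxx.
Qed.

Lemma is_wordE w (r : seq 'I_m) : @is_word m.+1 w r = word w (map val r).
Proof.
rewrite /is_word /word /sprod big_map eq_sym.
rewrite (eq_bigr (fun i : 'I_m => sref i)) => [|i _]; last exact: srefl_sref.
by rewrite all_map (introT allP) // => i _ /=.
Qed.

Lemma ord_seqE (r : seq nat) : all (fun k => k < m) r ->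
  exists r' : seq 'I_m, map val r' = r.
Proof.
elim: r => [|k r IHr] /=; first by exists [::].
by case/andP => km /IHr[r' <-]; exists (Ordinal km :: r').
Qed.

Lemma len_inv w : len w = ninv w.
Proof.
rewrite /len; case: ex_minnP => l /existsP[r]; rewrite is_wordE => wr hl.
apply/eqP; rewrite eqn_leq; apply/andP; split; last first.
  by rewrite (leq_trans (inv_word wr)) // size_map size_tuple.
have [s ws ss] := inv_word_exists w.
have /andP[as_ _] := ws; have [s' s'E] := ord_seqE as_.
apply: hl; rewrite -ss -s'E size_map; apply/existsP; exists (in_tuple s').
by rewrite is_wordE /= s'E.
Qed.

Lemma sprod_rev r : sprod (rev r) = (sprod r)^-1%g.
Proof.
elim: r => [|k r IHr]; first by rewrite /sprod !big_nil invg1.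
by rewrite rev_cons -cats1 sprod_cat sprod_seq1 IHr sprod_cons invMg srefV.
Qed.

Lemma inv_invg w : ninv w^-1%g = ninv w.
Proof.
suff le u : ninv u^-1%g <= ninv u by apply/eqP; rewrite eqn_leq le -{1}(invgK w) le.
have [r /andP[ar /eqP ru] <-] := inv_word_exists u.
by rewrite -(size_rev r) inv_word // /word all_rev ar sprod_rev ru eqxx.
Qed.

Lemma inv_ascR w k : k < m -> asc w^-1%g k -> ninv (w * sref k)%g = (ninv w).+1.
Proof.
by move=> km h; rewrite -inv_invg invMg srefV inv_asc // inv_invg.
Qed.

End Length.

Section ReducedWords.

Variable m : nat.
Implicit Types (w u v : 'S_m.+1) (x y : 'I_m.+1) (k : nat).

Lemma sref_id k x : x != k :> nat -> x != k.+1 :> nat -> k < m -> sref m k x = x.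
Proof.
by move=> /negPf h1 /negPf h2 km; apply: val_inj; rewrite /= srefE // h1 h2.
Qed.

Lemma sref_inord_id k j : j != k -> j != k.+1 -> k < m -> j <= m ->
  sref m k (inord j) = inord j.
Proof. by move=> h1 h2 km jm; apply: sref_id; rewrite ?inordK. Qed.

Lemma sref_comm i j : i.+1 < j -> j < m -> (sref m i * sref m j = sref m j * sref m i)%g.
Proof.
move=> ij jm; apply/commgP/conjg_fixP.
by rewrite tpermJ !sref_inord_id //; lia.
Qed.

Lemma sref_braid i : i.+1 < m ->
  (sref m i * (sref m i.+1 * sref m i) = sref m i.+1 * (sref m i * sref m i.+1))%g.
Proof.
move=> im; have -> : (sref m i * (sref m i.+1 * sref m i) = sref m i.+1 ^ sref m i)%g.
  by rewrite /conjg srefV.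
have -> : (sref m i.+1 * (sref m i * sref m i.+1) = sref m i ^ sref m i.+1)%g.
  by rewrite /conjg srefV.
rewrite [in LHS]tpermJ sref_r sref_inord_id; [|lia..].
by rewrite [in RHS]tpermJ sref_l sref_inord_id //; lia.
Qed.

Definition redw w r := word w r && (size r == ninv w).

Lemma redw_exists w : exists r, redw w r.
Proof.
have [r h1 h2] := inv_word_exists w; exists r; by rewrite /redw h1 h2 eqxx.
Qed.

Lemma word_cons w k r : word w (k :: r) = (k < m) && word (sref m k * w) r.
Proof.
rewrite /word /= sprod_cons -andbA; congr (_ && (_ && _)).
by rewrite -(inj_eq (mulgI (sref m k))) mulKsr.
Qed.

Lemma redw_cons w k r : k < m -> ~~ asc w k -> redw (sref m k * w) r ->
  redw w (k :: r).
Proof.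
move=> km dw; rewrite /redw word_cons km => /andP[-> /eqP szr] /=.
by rewrite szr (inv_desc km dw).
Qed.

Lemma redw_uncons w k r : redw w (k :: r) ->
  [/\ k < m, ~~ asc w k & redw (sref m k * w) r].
Proof.
rewrite /redw word_cons => /andP[/andP[km wr] /eqP sref].
have le := inv_word wr.
have dw : ~~ asc w k.
  by apply/negP => aw; move: le; rewrite inv_asc // -sref /= ltnNge leqW.
by move: sref; rewrite (inv_desc km dw) wr /= => -[->].
Qed.

Lemma asc_far w i j : i < m -> j < m -> (i.+1 < j) || (j.+1 < i) ->
  asc (sref m i * w) j = asc w j.
Proof.
by move=> im jm ij; rewrite /asc !permM !sref_inord_id //; lia.
Qed.

End ReducedWords.

(** * The elements T_w and Matsumoto's theorem *)

Section HeckeBasis.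

Local Open Scope ring_scope.

Variables (m : nat) (H : algType {poly int}) (t : 'I_m -> H).
Hypothesis Ht : @hecke_relations m.+1 H t.
Implicit Types (w u v : 'S_m.+1) (x y : 'I_m.+1) (k : nat).

Local Notation sref := (sref m).

(* Ts k is 0 when k is out of range. *)
Definition Ts k : H := if insub k is Some i then t i else 0.

Lemma TsE (i : 'I_m) : Ts i = t i.
Proof. by rewrite /Ts valK. Qed.

Lemma Ts_comm i j : (i.+1 < j)%N -> Ts i * Ts j = Ts j * Ts i.
Proof.
move=> ij; rewrite /Ts; case: insubP => [a _ ai|]; last by rewrite mul0r mulr0.
case: insubP => [b _ bj|]; last by rewrite mul0r mulr0.
by apply: (hecke_comm Ht); rewrite ai bj.
Qed.

Lemma Ts_braid i : (i.+1 < m)%N ->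
  Ts i * Ts i.+1 * Ts i = Ts i.+1 * Ts i * Ts i.+1.
Proof.
move=> im; have im' := ltnW im.
have -> : Ts i = t (Ordinal im') by rewrite -TsE.
have -> : Ts i.+1 = t (Ordinal im) by rewrite -TsE.
exact: (hecke_braid Ht).
Qed.

Lemma Ts_quad k : (k < m)%N -> Ts k * Ts k = 1 + 'X *: Ts k.
Proof.
move=> km; have -> : Ts k = t (Ordinal km) by rewrite -TsE.
exact: (hecke_quad Ht).
Qed.

Definition Tprod (r : seq nat) : H := \prod_(k <- r) Ts k.

Lemma Tprod_cons k r : Tprod (k :: r) = Ts k * Tprod r.
Proof. exact: big_cons. Qed.

Lemma Tprod_cat r s : Tprod (r ++ s) = Tprod r * Tprod s.
Proof. exact: big_cat. Qed.

Lemma Tprod_nil : Tprod [::] = 1.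
Proof. exact: big_nil. Qed.

Lemma Tprod_seq1 k : Tprod [:: k] = Ts k.
Proof. exact: big_seq1. Qed.

(** If two reduced words of w start with different letters i and j, both letters are descents, so w
    begins with the longest element of the subgroup generated by s_i and s_j. Reduced words passing
    through that element link the two given words, by induction on the length and one defining
    relation. *)
Theorem matsumoto w r r' : redw w r -> redw w r' -> Tprod r = Tprod r'.
Proof.
have [l] := ubnP (ninv w); elim: l w r r' => // l IHl w.
suff W i j r1 r2 : (i < j)%N -> (ninv w < l.+1)%N -> redw w (i :: r1) ->
    redw w (j :: r2) -> Tprod (i :: r1) = Tprod (j :: r2).
  case=> [|i r1] [|j r2] lw // hr hr'.
  - by move/andP: hr hr' => [_ /eqP h] /andP[_]; rewrite -h.
  - by move/andP: hr' hr => [_ /eqP h] /andP[_]; rewrite -h.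
  have [ij|ji|ij] := ltngtP i j; first exact: W.
    exact/esym/W.
  rewrite !Tprod_cons ij; congr (_ * _); subst j.
  have [im di h1] := redw_uncons hr; have [_ _ h2] := redw_uncons hr'.
  by apply: (IHl (sref i * w)%g) => //; rewrite -ltnS -(inv_desc im di).
move=> ij lw h1 h2.
have [im di g1] := redw_uncons h1; have [jm dj g2] := redw_uncons h2.
rewrite !Tprod_cons; have [ij1|ij1] : (i.+1 < j)%N \/ j = i.+1 by lia.
  have di' : ~~ asc (sref j * w)%g i by rewrite asc_far // ij1 orbT.
  have dj' : ~~ asc (sref i * w)%g j by rewrite asc_far // ij1.
  have [r hr] := redw_exists (sref j * (sref i * w))%g.
  rewrite (IHl _ r1 (j :: r) _ g1); first last.
  - exact: redw_cons.
  - by rewrite -ltnS -(inv_desc im di).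
  rewrite (IHl _ r2 (i :: r) _ g2); first last.
  - by apply: redw_cons; rewrite // mulgA (sref_comm ij1 jm) -mulgA.
  - by rewrite -ltnS -(inv_desc jm dj).
  by rewrite !Tprod_cons !mulrA Ts_comm.
subst j; have i2 : sref i.+1 (inord i) = inord i.
  by rewrite sref_inord_id //; lia.
have i3 : sref i (inord i.+2) = inord i.+2 by rewrite sref_inord_id //; lia.
have [r hr] := redw_exists (sref i * (sref i.+1 * (sref i * w)))%g.
rewrite (IHl _ r1 [:: i.+1, i & r] _ g1); first last.
- apply: redw_cons => //; last apply: redw_cons => //; move: di dj;
    rewrite /asc !permM ?sref_l ?sref_r ?i2 ?i3 ?sref_l ?sref_r; lia.
- by rewrite -ltnS -(inv_desc im di).
rewrite (IHl _ r2 [:: i, i.+1 & r] _ g2); first last.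
- apply: redw_cons => //; last apply: redw_cons => //.
  + move: di dj; rewrite /asc !permM ?sref_l ?sref_r ?i2 ?i3 ?sref_l ?sref_r; lia.
  + move: di dj; rewrite /asc !permM ?sref_l ?sref_r ?i2 ?i3 ?sref_l ?sref_r; lia.
  + by rewrite !mulgA -(mulgA (sref i.+1)) -sref_braid // !mulgA in hr *.
- by rewrite -ltnS -(inv_desc jm dj).
by rewrite !Tprod_cons !mulrA Ts_braid.
Qed.

Definition TT w : H := @Tw m.+1 H t w.

Lemma TTE w r : redw w r -> TT w = Tprod r.
Proof.
move=> wr; rewrite /TT /Tw; set s := reduced_word w.
have /andP[ws /eqP ss] : is_word w s && (size s == len w).
  exact: (xchooseP (reduced_word_exists w)).
rewrite (eq_bigr (fun i : 'I_m => Ts i)) => [|i _]; last by rewrite TsE.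
rewrite -(big_map val xpredT Ts); apply: (@matsumoto w) => //.
by rewrite /redw -is_wordE ws size_map ss len_inv eqxx.
Qed.

Lemma TT1 : TT 1%g = 1.
Proof.
rewrite (@TTE _ [::]) ?Tprod_nil // /redw /word inv1 /= /sprod big_nil.
by rewrite !eqxx.
Qed.

Lemma TT_asc w k : (k < m)%N -> asc w k -> TT (sref k * w)%g = Ts k * TT w.
Proof.
move=> km aw; have [r hr] := redw_exists w.
rewrite (TTE hr) -Tprod_cons; apply: TTE; apply: redw_cons => //.
  by rewrite asc_sref // negbK.
by rewrite mulKsr.
Qed.

Lemma TT_mul u v : ninv (u * v)%g = (ninv u + ninv v)%N ->
  TT (u * v)%g = TT u * TT v.
Proof.
have [r hr] := redw_exists u; have [s hs] := redw_exists v => huv.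
rewrite (TTE hr) (TTE hs) -Tprod_cat; apply: TTE; move: hr hs; rewrite /redw /word.
case/andP => /andP[ar /eqP ru] /eqP szr /andP[/andP[as_ /eqP sv] /eqP szs].
by rewrite all_cat ar as_ sprod_cat ru sv eqxx size_cat szr szs huv eqxx.
Qed.

Lemma TT_ascR w k : (k < m)%N -> asc w^-1%g k -> TT (w * sref k)%g = TT w * Ts k.
Proof.
move=> km aw; have TTk : TT (sref k) = Ts k.
  rewrite (@TTE _ [:: k]) ?Tprod_seq1 // /redw /word sprod_seq1 eqxx /= km /=.
  by rewrite -(mulg1 (sref k)) inv_asc // ?inv1 // /asc !perm1 !inordK // ltnW.
rewrite TT_mul ?TTk // inv_ascR //.
by rewrite -(mulg1 (sref k)) inv_asc ?inv1 ?addn1 // /asc !perm1 !inordK // ltnW.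
Qed.

Lemma TT_descR w k : (k < m)%N -> ~~ asc w^-1%g k ->
  TT w * Ts k = TT (w * sref k)%g + 'X *: TT w.
Proof.
move=> km dw; have aw : asc (w * sref k)^-1%g k by rewrite invMg srefV asc_sref.
have e : (w * sref k * sref k)%g = w by rewrite -mulgA sref2 mulg1.
rewrite -{1 3}e TT_ascR // -mulrA Ts_quad // mulrDr mulr1.
by rewrite scalerAr.
Qed.

End HeckeBasis.

(** * The trace form *)

Lemma perm_inord_neq m (x : 'S_m.+1) a b : a < b -> b <= m ->
  x (inord a) != x (inord b) :> nat.
Proof.
move=> ab bm; rewrite val_eqE (inj_eq perm_inj) -val_eqE /= !inordK ?ltn_eqF //.
exact: leq_trans ab (leqW bm).
Qed.

Lemma ltn_flip (a b : nat) : a != b -> (b < a) = ~~ (a < b).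
Proof. lia. Qed.

Lemma lt3_consistent (a b c : nat) :
  ~~ [&& a < b, b < c & ~~ (a < c)] && ~~ [&& ~~ (a < b), ~~ (b < c) & a < c].
Proof. lia. Qed.

(** The six vectors stand for x and its translates under two adjacent reflections; p, q, r record
    the order of the values of x at i and i+1, at i+1 and i+2, and at i and i+2. The first
    hypothesis discards the two cyclic patterns, and each of the six others is a linear identity. *)
Lemma braid_on_orbit (R : comNzRingType) n (P Q : 'M[R]_n) (X : R)
    (p q r : bool) (v v1 v2 v12 v21 v3 : 'rV[R]_n) :
  ~~ [&& p, q & ~~ r] && ~~ [&& ~~ p, ~~ q & r] ->
  (v *m P = if p then v1 else v1 + X *: v)%R ->
  (v *m Q = if q then v2 else v2 + X *: v)%R ->
  (v1 *m P = if ~~ p then v else v + X *: v1)%R ->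
  (v1 *m Q = if r then v12 else v12 + X *: v1)%R ->
  (v2 *m P = if r then v21 else v21 + X *: v2)%R ->
  (v2 *m Q = if ~~ q then v else v + X *: v2)%R ->
  (v12 *m P = if q then v3 else v3 + X *: v12)%R ->
  (v12 *m Q = if ~~ r then v1 else v1 + X *: v12)%R ->
  (v21 *m P = if ~~ r then v2 else v2 + X *: v21)%R ->
  (v21 *m Q = if p then v3 else v3 + X *: v21)%R ->
  (v *m P *m Q *m P = v *m Q *m P *m Q)%R.
Proof.
case: p q r => [] [] [] //= _ F0 F0' F1 F2 F3 F4 F5 F6 F7 F8;
rewrite ?(F0, F0', F1, F2, F3, F4, F5, F6, F7, F8, mulmxDl, =^~ scalemxAl) //;
by apply/rowP => b; rewrite !mxE; ring.
Qed.

Section TraceForm.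

Local Open Scope ring_scope.

Variables (m : nat) (H : algType {poly int}) (t : 'I_m -> H).
Hypothesis Ht : @hecke_relations m.+1 H t.
Implicit Types (w u v x y : 'S_m.+1) (k j : nat) (g h : H).

Local Notation sref := (sref m).
Local Notation Ts := (Ts t).
Local Notation TT := (TT t).
Local Notation Tprod := (Tprod t).

Section RegularRepresentation.

Let N := #|{: 'S_m.+1}|.-1.

Fact card_perm_pred : #|{: 'S_m.+1}| = N.+1.
Proof. by rewrite prednK //; apply/card_gt0P; exists 1%g. Qed.

Let ix x : 'I_N.+1 := cast_ord card_perm_pred (enum_rank x).
Let xi (a : 'I_N.+1) : 'S_m.+1 := enum_val (cast_ord (esym card_perm_pred) a).

Let ixK : cancel ix xi.
Proof. by move=> x; rewrite /xi /ix cast_ordK enum_rankK. Qed.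

Let xiK : cancel xi ix.
Proof. by move=> a; rewrite /xi /ix enum_valK cast_ordKV. Qed.

Let e x : 'rV[{poly int}]_N.+1 := delta_mx 0 (ix x).

(* Right multiplication by Ts k, where the row e x stands for TT x^-1. *)
Let B k : 'M[{poly int}]_N.+1 :=
  \matrix_(a < N.+1) (if asc (xi a) k then e (sref k * xi a)%g
    else e (sref k * xi a)%g + 'X *: e (xi a)).

Let eB x k : e x *m B k =
  if asc x k then e (sref k * x)%g else e (sref k * x)%g + 'X *: e x.
Proof. by rewrite -rowE rowK ixK. Qed.

Let eq_on_e (M M' : 'M[{poly int}]_N.+1) :
  (forall x, e x *m M = e x *m M') -> M = M'.
Proof. by move=> eM; apply/row_matrixP => a; rewrite !rowE -(xiK a) eM. Qed.

Lemma regular_hecke : @hecke_relations m.+1 'M[{poly int}]_N.+1 (fun i : 'I_m => B i).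
Proof.
split=> [i j ij|i j ij|i].
- apply: eq_on_e => x; have [im jm] := (ltn_ord i, ltn_ord j).
  have hji : asc (sref j * x)%g i = asc x i by rewrite asc_far // ij orbT.
  have hij : asc (sref i * x)%g j = asc x j by rewrite asc_far // ij.
  have ss : (sref j * (sref i * x) = sref i * (sref j * x))%g.
    by rewrite mulgA -sref_comm // mulgA.
  rewrite -!mulmxE !mulmxA !eB.
  case: ifP => ai; case: ifP => aj;
    rewrite ?(mulmxDl, =^~ scalemxAl) !eB ?hij ?hji ?ai ?aj ?ss //;
  by apply/rowP => b; rewrite !mxE; ring.
- have im : (i.+1 < m)%N by rewrite -ij ltn_ord.
  rewrite ij; apply: eq_on_e => x.
  have ss := sref_braid im.
  rewrite -!mulmxE !mulmxA.
  have i2 : sref i.+1 (inord i) = inord i by rewrite sref_inord_id //; lia.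
  have i3 : sref i (inord i.+2) = inord i.+2 by rewrite sref_inord_id //; lia.
  have [p pE] : exists p, p = asc x i by eexists.
  have [q qE] : exists q, q = asc x i.+1 by eexists.
  have [r rE] : exists r, r = (x (inord i) < x (inord i.+2))%N by eexists.
  have x1 : x (inord i) != x (inord i.+1) :> nat.
    by apply: perm_inord_neq => //; lia.
  have x2 : x (inord i.+1) != x (inord i.+2) :> nat.
    by apply: perm_inord_neq => //; lia.
  have x3 : x (inord i) != x (inord i.+2) :> nat.
    by apply: perm_inord_neq => //; lia.
  pose y1 := (sref i * x)%g; pose y2 := (sref i.+1 * x)%g.
  pose y12 := (sref i.+1 * y1)%g; pose y21 := (sref i * y2)%g.
  pose y3 := (sref i * y12)%g.
  have y3E : (sref i.+1 * y21)%g = y3.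
    by rewrite /y3 /y12 /y1 /y21 /y2 !mulgA in ss *; rewrite ss.
  have [a1 a2] : asc y1 i = ~~ p /\ asc y1 i.+1 = r.
    by rewrite pE rE /asc !permM !(sref_l, sref_r, i2, i3); split; rewrite // [LHS]ltn_flip.
  have [a3 a4] : asc y2 i = r /\ asc y2 i.+1 = ~~ q.
    by rewrite qE rE /asc !permM !(sref_l, sref_r, i2, i3); split; rewrite // [LHS]ltn_flip.
  have [a5 a6] : asc y12 i = q /\ asc y12 i.+1 = ~~ r.
    by rewrite qE rE /asc !permM !(sref_l, sref_r, i2, i3); split; rewrite // [LHS]ltn_flip.
  have [a7 a8] : asc y21 i = ~~ r /\ asc y21 i.+1 = p.
    by rewrite pE rE /asc !permM !(sref_l, sref_r, i2, i3); split; rewrite // [LHS]ltn_flip.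
  have y11 : (sref i * y1)%g = x by rewrite mulKsr.
  have y22 : (sref i.+1 * y2)%g = x by rewrite mulKsr.
  have y121 : (sref i.+1 * y12)%g = y1 by rewrite mulKsr.
  have y212 : (sref i * y21)%g = y2 by rewrite mulKsr.
  have pqr : ~~ [&& p, q & ~~ r] && ~~ [&& ~~ p, ~~ q & r].
    by rewrite pE qE rE; apply: lt3_consistent.
  have E1 z1 z2 k b : asc z1 k = b -> (sref k * z1)%g = z2 ->
      e z1 *m B k = if b then e z2 else e z2 + 'X *: e z1.
    by move=> <- <-; rewrite eB.
  have F0 := E1 _ _ _ _ (esym pE) (erefl y1).
  have F0' := E1 _ _ _ _ (esym qE) (erefl y2).
  have F1 := E1 _ _ _ _ a1 y11; have F2 := E1 _ _ _ _ a2 (erefl y12).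
  have F3 := E1 _ _ _ _ a3 (erefl y21); have F4 := E1 _ _ _ _ a4 y22.
  have F5 := E1 _ _ _ _ a5 (erefl y3); have F6 := E1 _ _ _ _ a6 y121.
  have F7 := E1 _ _ _ _ a7 y212; have F8 := E1 _ _ _ _ a8 y3E.
  exact: braid_on_orbit pqr F0 F0' F1 F2 F3 F4 F5 F6 F7 F8.
- apply: eq_on_e => x; have im := ltn_ord i.
  rewrite expr2 -!mulmxE mulmxA mulmxDr -scalemxAr !eB.
  have -> : e x *m (1 : 'M_N.+1) = e x by rewrite mulmx1.
  case: ifP => ai; rewrite ?(mulmxDl, =^~ scalemxAl) !eB asc_sref // ai /= mulKsr;
  by apply/rowP => b; rewrite !mxE; ring.
Qed.

Hypothesis hH : @is_hecke_algebra m.+1 H t.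

(** The value of [tau] at h is the coordinate of [e 1] in the image of [e 1] under [f h]. The image
    of [e 1] under [f (TT w)] is the basis vector [e w^-1], built up one ascent at a time. *)
Theorem trace_form_exists : exists tau : {scalar H},
  forall w, tau (TT w) = (w == 1%g)%:R.
Proof.
have [f ft] := hecke_lift hH regular_hecke.
have fE k : (k < m)%N -> f (Ts k) = B k.
  by move=> km; rewrite -[k]/(val (Ordinal km)) TsE ft.
pose tau0 h : {poly int} := (e 1%g *m f h) 0 (ix 1%g).
have lin : scalar tau0.
  by move=> a g h; rewrite /tau0 linearP mulmxDr -scalemxAr !mxE.
pose tau : {scalar H} := HB.pack tau0 (GRing.isLinear.Build _ _ _ _ tau0 lin).
exists tau => w; rewrite /tau /=.
rewrite /tau0; have -> : e 1%g *m f (TT w) = e w^-1%g.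
  rewrite -{1}(invgK w); elim/perm_ind: w^-1%g => [|x k km ax IHx].
    by rewrite invg1 TT1 // rmorph1 mulmx1.
  rewrite invMg srefV TT_ascR ?invgK // rmorphM /= -mulmxE mulmxA IHx fE //.
  by rewrite eB ax.
rewrite /e mxE eqxx /= (inj_eq (can_inj ixK)) eq_sym.
by rewrite -(inj_eq invg_inj) invgK invg1.
Qed.

End RegularRepresentation.
End TraceForm.

(** * Trace functions and the symmetrizing form *)

Section Traces.

Local Open Scope ring_scope.

Variables (m : nat) (H : algType {poly int}) (t : 'I_m -> H).
Hypothesis Ht : @hecke_relations m.+1 H t.
Variable tau : {scalar H}.
Hypothesis tauT : forall w, tau (TT t w) = (w == 1%g)%:R.
Implicit Types (w u v x y : 'S_m.+1) (k j : nat) (a g h : H).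

Local Notation sref := (sref m).
Local Notation Ts := (Ts t).
Local Notation TT := (TT t).
Local Notation Tprod := (Tprod t).

(** The subalgebra generated by the [Ts j] with [j < k]. The only product among its rules is right
    multiplication by a generator, so that inductions handle one letter at a time; closure under
    products is [hgenM]. *)
Inductive gen k : H -> Prop :=
| gen_1 : gen k 1
| gen_lin c g h : gen k g -> gen k h -> gen k (c *: g + h)
| gen_mulr g j : gen k g -> (j < k)%N -> gen k (g * Ts j).

Lemma gen_0 k : gen k 0.
Proof. by rewrite -(addNr 1) -scaleN1r; apply: gen_lin; apply: gen_1. Qed.

Lemma hgenD k g h : gen k g -> gen k h -> gen k (g + h).
Proof. by rewrite -{2}(scale1r g); apply: gen_lin. Qed.

Lemma hgenZ k c g : gen k g -> gen k (c *: g).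
Proof. by move=> kg; rewrite -[X in gen k X]addr0; apply: gen_lin => //; apply: gen_0. Qed.

Lemma hgenB k g h : gen k g -> gen k h -> gen k (g - h).
Proof. by move=> kg kh; rewrite addrC -scaleN1r; apply: gen_lin. Qed.

Lemma gen_Ts k j : (j < k)%N -> gen k (Ts j).
Proof. by move=> jk; rewrite -[Ts j]mul1r; apply: gen_mulr => //; apply: gen_1. Qed.

Lemma gen_sum k (I : finType) (P : pred I) (F : I -> H) :
  (forall i, P i -> gen k (F i)) -> gen k (\sum_(i | P i) F i).
Proof.
by move=> kF; elim/big_ind: _ => //; [apply: gen_0 | move=> *; apply: hgenD].
Qed.

Lemma hgenM k g h : gen k g -> gen k h -> gen k (g * h).
Proof.
move=> kg; elim=> [|c h1 h2 _ IH1 _ IH2|h1 j _ IH jk].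
- by rewrite mulr1.
- by rewrite mulrDr -scalerAr; apply: gen_lin.
- by rewrite mulrA; apply: gen_mulr.
Qed.

Lemma gen_Tprod k r : all (fun j => (j < k)%N) r -> gen k (Tprod r).
Proof.
elim: r => [|j r IHr] /=; first by rewrite Tprod_nil => _; apply: gen_1.
case/andP => jk /IHr kr; rewrite Tprod_cons.
by apply: hgenM => //; apply: gen_Ts.
Qed.

Lemma gen_le k l g : (k <= l)%N -> gen k g -> gen l g.
Proof.
move=> kl; elim=> [|c g1 g2 _ IH1 _ IH2|g1 j _ IH jk]; first exact: gen_1.
  exact: gen_lin.
by apply: gen_mulr => //; apply: leq_trans kl.
Qed.

Lemma gen_TT w : gen m (TT w).
Proof.
have [r hr] := redw_exists w; rewrite (TTE Ht hr); apply: gen_Tprod.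
by case/andP: hr => /andP[].
Qed.

Lemma gen_comm k g h : (forall j, (j < k)%N -> Ts j * h = h * Ts j) ->
  gen k g -> g * h = h * g.
Proof.
move=> hc; elim=> [|c g1 g2 _ IH1 _ IH2|g1 j _ IH jk].
- by rewrite mulr1 mul1r.
- by rewrite mulrDl mulrDr -scalerAl -scalerAr IH1 IH2.
- by rewrite -mulrA hc // mulrA IH mulrA.
Qed.

Lemma gen_span g : gen m g -> exists c : 'S_m.+1 -> {poly int},
  g = \sum_w c w *: TT w.
Proof.
elim=> [|c g1 g2 _ [c1 ->] _ [c2 ->]|g1 j _ [c1 ->] jm].
- exists (fun w => (w == 1%g)%:R); rewrite (bigD1 1%g) //= big1 => [|w /negPf->].
    by rewrite eqxx scale1r addr0 TT1.
  by rewrite scale0r.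
- exists (fun w => c * c1 w + c2 w); rewrite scaler_sumr -big_split /=.
  by apply: eq_bigr => w _; rewrite scalerDl scalerA.
(* In [g1 * Ts j] the coefficient at w collects that of [w * sref j] and, when j is a right descent
   of w, xi times that of w itself. *)
pose b w : {poly int} := (~~ asc w^-1%g j)%:R.
exists (fun w => c1 (w * sref j)%g + c1 w * b w * 'X).
under [RHS]eq_bigr => w _ do rewrite scalerDl.
rewrite big_split /= [X in _ = X + _](reindex_inj (mulIg (sref j))) /= -big_split mulr_suml /=.
apply: eq_bigr => w _; rewrite -mulgA sref2 mulg1 -scalerAl /b.
case: (boolP (asc w^-1%g j)) => aw.
  by rewrite TT_ascR // mulr0 mul0r scale0r addr0.
by rewrite TT_descR // scalerDr mulr1 scalerA.
Qed.

(** The T_x and the T_(x^-1) are dual bases. Passing a letter of y over to x creates a second term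
    only at a right descent of x, and that term has trace zero. *)
Lemma tau_TT2 x y : tau (TT x * TT y) = (x * y == 1)%g%:R.
Proof.
elim/perm_ind: y x => [|y k km ay IHy] x; first by rewrite TT1 // mulr1 mulg1 tauT.
rewrite TT_asc // mulrA; case: (boolP (asc x^-1%g k)) => ax.
  by rewrite -TT_ascR // IHy mulgA.
rewrite TT_descR // mulrDl linearD /= IHy -scalerAl linearZ /= IHy -mulgA.
(* If xy = 1, then y = x^-1 would have k both as an ascent and as a descent. *)
have [xy|_] := eqVneq (x * y)%g 1%g; last by rewrite mulr0n mulr0 addr0.
have /eqP xy' : x^-1%g == y by rewrite eq_invg_mul xy.
by move: ax; rewrite xy' ay.
Qed.

Lemma tau_coef (c : 'S_m.+1 -> {poly int}) w :
  tau ((\sum_v c v *: TT v) * TT w^-1%g) = c w.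
Proof.
rewrite mulr_suml linear_sum (bigD1 w) //= -scalerAl linearZ /= tau_TT2 mulgV.
rewrite eqxx mulr1 big1 ?addr0 // => v /negPf vw.
by rewrite -scalerAl linearZ /= tau_TT2 -eq_mulgV1 vw mulr0n mulr0.
Qed.

Lemma tauC g h : gen m g -> gen m h -> tau (g * h) = tau (h * g).
Proof.
move=> /gen_span[c ->] /gen_span[d ->].
rewrite mulr_suml mulr_sumr !linear_sum; apply: eq_bigr => w _.
rewrite mulr_suml mulr_sumr !linear_sum; apply: eq_bigr => v _.
rewrite -!scalerAl -!scalerAr !linearZ /= !tau_TT2 mulrCA.
by congr (_ * (_ * _%:R)); rewrite -!eq_invg_mul -(inj_eq invg_inj) invgK eq_sym.
Qed.

Inductive bimodule k : H -> Prop :=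
| bimodule_gen g : gen k g -> bimodule k g
| bimodule_mid g h : gen k g -> gen k h -> bimodule k (g * Ts k * h)
| bimodule_lin c g h : bimodule k g -> bimodule k h -> bimodule k (c *: g + h).

Lemma bimodule_mulr_comm k g h : (k < m)%N -> gen k g -> gen k h ->
  h * Ts k = Ts k * h -> bimodule k (g * Ts k * h * Ts k).
Proof.
move=> km kg kh hk; rewrite -(mulrA (g * _)) hk mulrA -(mulrA g) Ts_quad //.
rewrite mulrDr mulr1 mulrDl addrC -scalerAr -scalerAl.
by apply: bimodule_lin; [apply: bimodule_mid | apply: bimodule_gen; apply: hgenM].
Qed.

(** The critical product is g1 T_(k+1) g2 T_(k+1) with g2 one level lower. By induction g2 either
    commutes with T_(k+1), and the quadratic relation applies, or is h1 T_k h2 with h1 and h2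
    commuting with T_(k+1), and the braid relation leaves a single T_(k+1). *)
Lemma gen_bimodule k g : (k < m)%N -> gen k.+1 g -> bimodule k g.
Proof.
elim: k g => [|k IHk] g km; elim=> {g} [|c g h _ IHg _ IHh|g j _ IHg jk].
- exact/bimodule_gen/gen_1.
- exact: bimodule_lin.
- have -> : j = 0%N by lia.
  elim: IHg => [g1 g1k|g1 g2 g1k g2k|c g1 g2 _ IH1 _ IH2].
  + by rewrite -[_ * _]mulr1; apply: bimodule_mid => //; apply: gen_1.
  + by apply: bimodule_mulr_comm => //; apply: (@gen_comm 0).
  + by rewrite mulrDl -scalerAl; apply: bimodule_lin.
- exact/bimodule_gen/gen_1.
- exact: bimodule_lin.
elim: IHg => [g1 g1k|g1 g2 g1k g2k|c g1 g2 _ IH1 _ IH2]; last first.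
- by rewrite mulrDl -scalerAl; apply: bimodule_lin.
- have [jk'|jk'] : (j < k.+1)%N \/ j = k.+1 by lia.
    by rewrite -mulrA; apply: bimodule_mid => //; apply: gen_mulr.
  rewrite jk' {jk jk' j}.
  elim: (IHk _ (ltnW km) g2k) => [h hk|h1 h2 h1k h2k|c h1 h2 _ IH1 _ IH2].
  + apply: bimodule_mulr_comm => //; first exact: gen_le hk.
    by apply: gen_comm hk => j jk; rewrite Ts_comm.
  + have c1 : h1 * Ts k.+1 = Ts k.+1 * h1.
      by apply: gen_comm h1k => j jk; rewrite Ts_comm.
    have c2 : h2 * Ts k.+1 = Ts k.+1 * h2.
      by apply: gen_comm h2k => j jk; rewrite Ts_comm.
    rewrite -!mulrA c2 (mulrA _ h1) -c1 -mulrA (mulrA _ (Ts k)) (mulrA _ (Ts k.+1)).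
    rewrite -(Ts_braid Ht) // !mulrA -(mulrA _ (Ts k) h2).
    rewrite -(mulrA _ (Ts k.+1)); rewrite !mulrA.
    rewrite -(mulrA _ _ h2).
    apply: bimodule_mid.
      by apply: gen_mulr => //; apply: hgenM => //; apply: gen_le h1k.
    by apply: hgenM; [apply: gen_Ts | apply: gen_le h2k].
  + rewrite mulrDr mulrDl -scalerAr -scalerAl.
    exact: bimodule_lin.
- have [jk'|->] : (j < k.+1)%N \/ j = k.+1 by lia.
    by apply: bimodule_gen; apply: gen_mulr.
  by rewrite -[_ * _]mulr1; apply: bimodule_mid => //; apply: gen_1.
Qed.

Definition increasing_word J := sorted ltn J && all (fun j => (j < m)%N) J.

(* An element b * Ts k * c * Y, with b and c in gen k and Y a word in larger
   generators, is equal to c * b * (Ts k * Y) modulo commutators. *)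
Theorem trace_eq0 (psi : {scalar H}) :
  (forall g h, gen m g -> gen m h -> psi (g * h) = psi (h * g)) ->
  (forall J, increasing_word J -> psi (Tprod J) = 0) ->
  forall g, gen m g -> psi g = 0.
Proof.
move=> psiC psi0.
suff W k : (k <= m)%N -> forall g, gen k g -> forall J, increasing_word J ->
    all (leq k) J -> psi (g * Tprod J) = 0.
  by move=> g mg; rewrite -[g]mulr1 -(Tprod_nil t) (W m).
elim: k => [|k IHk] km g.
  elim=> [|c g1 g2 _ IH1 _ IH2|g1 j _ _ //] J incJ Jk.
    by rewrite mul1r psi0.
  by rewrite mulrDl -scalerAl linearP /= IH1 // IH2 // mulr0 addr0.
move=> kg J incJ Jk; have /andP[sJ mJ] := incJ.
elim: (gen_bimodule km kg) => {kg} [h hk|h1 h2 h1k h2k|c h1 h2 _ IH1 _ IH2].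
- by apply: IHk; rewrite ?(ltnW km) //; apply: sub_all Jk => j; apply: ltnW.
- have c2 : h2 * Tprod J = Tprod J * h2.
    apply: gen_comm h2k => j jk; elim: (J) Jk => [|i I IHI] /=.
      by rewrite Tprod_nil mulr1 mul1r.
    case/andP => ki /IHI hI; rewrite Tprod_cons mulrA Ts_comm -?mulrA ?hI //.
    exact: leq_ltn_trans jk ki.
  have mk h : gen k h -> gen m h by apply: gen_le; apply: ltnW.
  have mJ' : gen m (Tprod J) by apply: gen_Tprod.
  rewrite -mulrA c2 mulrA psiC; [|apply: hgenM => //|exact: mk]; last first.
    by apply: hgenM; [exact: mk | apply: gen_Ts].
  rewrite !mulrA -mulrA -Tprod_cons; apply: IHk => //; first exact: ltnW.
  - exact: hgenM.
  - by rewrite /increasing_word /= km mJ (path_sortedE ltn_trans) sJ Jk.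
  - by rewrite /= leqnn; apply: sub_all Jk => j; apply: ltnW.
- by rewrite mulrDl -scalerAl linearP /= IH1 IH2 mulr0 addr0.
Qed.

Lemma central_eq0 z : gen m z ->
  (forall k, (k < m)%N -> Ts k * z = z * Ts k) ->
  (forall J, increasing_word J -> tau (z * Tprod J) = 0) -> z = 0.
Proof.
move=> mz zc z0; have lin : scalar (fun h => tau (z * h)).
  by move=> c g h; rewrite mulrDr -scalerAr linearP.
pose psi : {scalar H} := HB.pack (fun h => tau (z * h))
  (GRing.isLinear.Build _ _ _ _ (fun h => tau (z * h)) lin).
have psiE : forall g, gen m g -> psi g = 0.
  apply: trace_eq0 => // g h mg mh; rewrite /psi /=.
  by rewrite mulrA tauC ?mulrA //; [rewrite (gen_comm zc mh) | apply: hgenM].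
have [c zE] := gen_span mz; rewrite zE big1 // => w _.
by rewrite -(tau_coef c w) -zE [tau _](psiE _ (gen_TT _)) scale0r.
Qed.

End Traces.

(** * Parabolic subgroups and relative norms *)

Section Parabolic.

Variable m : nat.
Implicit Types (u v w d : 'S_m.+1) (x y : 'I_m.+1) (J : seq nat).

Local Notation sref := (sref m).

(* The points x and y lie in the same block of the composition whose simple
   reflections are indexed by J. *)
Definition linked J (x y : nat) : bool :=
  all (fun k => k \in J) (iota (minn x y) (maxn x y - minn x y)).

(** An index k missing from J is a cut between the points k and k+1; points are linked when no cut
    separates them. In this form linkedness is visibly an equivalence relation and is accessible to
    linear arithmetic. *)
Lemma linkedP J (x y : nat) :
  reflect (forall k, k \notin J -> (x <= k) = (y <= k)) (linked J x y).
Proof.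
apply: (iffP allP) => h k.
  move=> kJ; apply/idP/idP => hk; rewrite leqNgt; apply/negP => hk';
  by move: kJ; rewrite h // mem_iota; lia.
rewrite mem_iota => hk; apply: contraT => /h; lia.
Qed.

Lemma linked_refl J (x : nat) : linked J x x.
Proof. by apply/linkedP. Qed.

Lemma linked_sym J (x y : nat) : linked J x y = linked J y x.
Proof. by rewrite /linked minnC maxnC. Qed.

Lemma linked_trans J : transitive (linked J).
Proof.
move=> y x z /linkedP h1 /linkedP h2; apply/linkedP => k kJ.
by rewrite h1 // h2.
Qed.

Lemma linkedS J k : linked J k k.+1 = (k \in J).
Proof.
apply/linkedP/idP => [h|kJ i iJ].
  by apply: contraT => /h; rewrite leqnn ltnn.
have : i != k by apply: contraNneq iJ => ->.
lia.
Qed.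

Lemma linked_between J (x y z : nat) : linked J x y -> x <= z -> z <= y ->
  linked J x z.
Proof.
move=> /linkedP h xz zy; apply/linkedP => k kJ.
by have := h k kJ; lia.
Qed.

(** The standard parabolic subgroup, described as the permutations preserving every block;
    [gen_srefl] identifies it with the generated subgroup. *)
Definition WJ J : {set 'S_m.+1} := 
  [set u : 'S_m.+1 | [forall x : 'I_m.+1, linked J (u x) x]].

Lemma WJP J u : reflect (forall x, linked J (u x) x) (u \in WJ J).
Proof. by rewrite inE; apply: forallP. Qed.

Lemma WJ_group_set J : group_set (WJ J).
Proof.
apply/group_setP; split=> [|u v /WJP hu /WJP hv].
  by apply/WJP => x; rewrite perm1 linked_refl.
by apply/WJP => x; rewrite permM; apply: linked_trans (hv _) (hu _).
Qed.
Canonical WJ_group J := Group (WJ_group_set J).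

Lemma tperm_WJ J x y : linked J x y -> tperm x y \in WJ J.
Proof.
move=> xy; apply/WJP => z; case: tpermP => [->|->|_ _]; last exact: linked_refl.
  by rewrite linked_sym.
by [].
Qed.

Lemma sref_WJ J k : k < m -> (sref k \in WJ J) = (k \in J).
Proof.
move=> km; have k1 : (inord k : 'I_m.+1) = k :> nat by rewrite inordK // ltnW.
have k2 : (inord k.+1 : 'I_m.+1) = k.+1 :> nat by rewrite inordK.
apply/idP/idP => [/WJP/(_ (inord k))|kJ].
  by rewrite sref_l k1 k2 linked_sym linkedS.
by apply: tperm_WJ; rewrite k1 k2 linkedS.
Qed.

Lemma WJ_desc J u k : k < m -> u \in WJ J -> ~~ asc u k -> k \in J.
Proof.
move=> km /WJP hu; apply: contraR => kJ; rewrite /asc.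
have /linkedP/(_ k kJ) := hu (inord k).
have /linkedP/(_ k kJ) := hu (inord k.+1).
rewrite !inordK //; lia.
Qed.

Lemma WJ_ind J (P : 'S_m.+1 -> Prop) : P 1%g ->
  (forall u k, k < m -> k \in J -> asc u k -> u \in WJ J -> P u ->
    P (sref k * u)%g) ->
  forall u, u \in WJ J -> P u.
Proof.
move=> P1 PS u; have [l] := ubnP (ninv u); elim: l u => // l IHl u lu uJ.
case: (boolP [forall k : 'I_m, asc u k]) => [/forallP au|].
  by rewrite (asc_mono (fun k km => au (Ordinal km))).
rewrite negb_forall => /existsP[k nk].
have kJ := WJ_desc (ltn_ord k) uJ nk.
have skuJ : (sref k * u)%g \in WJ J by rewrite groupM ?sref_WJ.
rewrite -(mulKsr k u); apply: PS => //; first by rewrite asc_sref.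
by apply: IHl => //; rewrite -ltnS -(inv_desc _ nk).
Qed.

Lemma gen_srefl (s : seq 'I_m) :
  <<[set @srefl m.+1 i | i in s]>>%g = WJ (map val s).
Proof.
apply/eqP; rewrite eqEsubset; apply/andP; split.
  rewrite gen_subG; apply/subsetP => _ /imsetP[i is_ ->].
  by rewrite srefl_sref sref_WJ // map_f.
apply/subsetP; apply: WJ_ind => [|u k km kJ _ _ IHu]; first exact: group1.
rewrite groupM //; apply: mem_gen; case/mapP: kJ => i is_ ->.
by rewrite -srefl_sref; apply: imset_f.
Qed.

Lemma parabolicE la : all (leq 1) la -> sumn la = m.+1 ->
  parabolic m.+1 la = WJ_group (block_word 0 la).
Proof.
move=> pos sumla; apply: val_inj; rewrite /= gen_srefl.
by congr (WJ _); apply: (@comp_wordE m.+1).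
Qed.

(** The distinguished representatives of the right cosets of [WJ J], described as the permutations
    increasing on every block; see [dist_repsE]. *)
Definition DJ J d := all (asc d) J.

Lemma DJ_mono J d x y : DJ J d -> linked J x y -> x < y -> d x < d y.
Proof.
move=> /allP Dd; have [l] := ubnP (y - x); elim: l y => // l IHl y yx xy lt_xy.
have y1 : y.-1 < m.+1 by rewrite (leq_ltn_trans (leq_pred _)).
have y1J : y.-1 \in J.
  move/allP: xy; apply; rewrite mem_iota; lia.
have y'y : d (inord y.-1) < d y.
  have := Dd _ y1J; rewrite /asc prednK ?inord_val //; lia.
have [xy'|xy'] : x = y.-1 :> nat \/ x < y.-1 by lia.
  by rewrite -xy' inord_val in y'y.
apply: ltn_trans y'y; apply: IHl; rewrite ?inordK //; first lia.
by apply: linked_between xy _ _; lia.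
Qed.

Lemma WJ_DJ_asc J u d k : k < m -> k \in J -> u \in WJ J -> DJ J d ->
  asc (u * d)%g k = asc u k.
Proof.
move=> km kJ /WJP uJ Dd; rewrite /asc !permM.
have lk : linked J (u (inord k)) (u (inord k.+1)).
  apply: linked_trans (uJ _) _; rewrite linked_sym.
  apply: linked_trans (uJ _) _; rewrite linked_sym !inordK //.
    by rewrite linkedS.
  exact: ltnW.
apply/idP/idP => [|h]; last exact: DJ_mono Dd lk h.
have := perm_inord_neq u (ltnSn k) km.
rewrite neq_ltn => /orP[//|h].
have := DJ_mono Dd _ h; rewrite linked_sym => /(_ lk); lia.
Qed.

Lemma ninv_WD J u d : all (fun k => k < m) J -> u \in WJ J -> DJ J d ->
  ninv (u * d)%g = ninv u + ninv d.
Proof.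
move=> mJ uJ Dd; elim/WJ_ind: uJ => [|v k km kJ av vJ IHv].
  by rewrite mul1g inv1.
by rewrite -mulgA !inv_asc ?(WJ_DJ_asc (J := J)) // IHv.
Qed.

Lemma dist_repsE J : all (fun k => k < m) J ->
  dist_reps [set: 'S_m.+1] (WJ_group J) = [set d | DJ J d].
Proof.
move=> mJ; apply/setP => d; rewrite !inE /=; apply/forall_inP/idP => [h|Dd].
  apply/allP => k kJ; apply: contraT => dk.
  have km := allP mJ _ kJ.
  have := h (sref k * d)%g; rewrite !len_inv (inv_desc km dk) ltnn.
  by apply; rewrite mem_rcoset mulgK sref_WJ.
move=> _ /rcosetP[u uJ ->]; rewrite !len_inv (ninv_WD mJ) //.
exact: leq_addl.
Qed.

Lemma dist_reps1 (G : {group 'S_m.+1}) : dist_reps G 1%G = G.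
Proof.
apply/setP => d; rewrite inE andb_idr // => _.
by apply/forall_inP => x; rewrite mul1g inE => /eqP->.
Qed.

(** The set Z is a union of right cosets of [WJ J], and each coset holds exactly one permutation
    increasing on the blocks: an element of least length is one, and two of them differ by an
    element of [WJ J] without descents. *)
Lemma card_DJ J (Z : {set 'S_m.+1}) : all (fun k => k < m) J ->
  (forall u z, u \in WJ J -> z \in Z -> (u * z)%g \in Z) ->
  #|Z| = #|[set d in Z | DJ J d]| * #|WJ J|.
Proof.
move=> mJ WZ; rewrite mulnC -cardsX.
pose f (p : 'S_m.+1 * 'S_m.+1) := (p.1 * p.2)%g.
rewrite -(card_in_imset (f := f)).
  apply: eq_card => z; apply/idP/imsetP => [zZ|[[u d]]]; last first.
    by rewrite !inE /= => /and3P[uJ dZ _] ->; apply: WZ; rewrite ?inE.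
  pose u := [arg min_(v < 1%g in WJ J) ninv (v * z)%g].
  have [uJ umin] : u \in WJ J /\ forall v, v \in WJ J ->
      ninv (u * z)%g <= ninv (v * z)%g.
    by rewrite /u; case: arg_minnP; [apply: group1 | move=> ? ? ?; split].
  exists (u^-1%g, (u * z)%g); last by rewrite /f /= mulKg.
  rewrite inE /= groupV uJ inE WZ //=; apply/allP => k kJ; apply: contraT => dk.
  have km := allP mJ _ kJ.
  have := umin (sref k * u)%g; rewrite -mulgA (inv_desc km dk) ltnn; apply.
  by rewrite groupM ?sref_WJ.
move=> [u d] [u' d'] /setXP[/= uJ /setIdP[_ Dd]] /setXP[/= u'J /setIdP[_ Dd']].
rewrite /f /= => ud.
have d'E : (u'^-1 * u * d)%g = d' by rewrite -mulgA ud mulKg.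
have vJ : (u'^-1 * u)%g \in WJ J by rewrite groupM ?groupV.
have v1 : (u'^-1 * u)%g = 1%g.
  apply: asc_mono => k km; apply: contraT => vk.
  have kJ := WJ_desc km vJ vk.
  by move: vk; rewrite -(WJ_DJ_asc km kJ vJ Dd) d'E (allP Dd' _ kJ).
have -> : u = u' by rewrite -(mulKVg u' u) v1 mulg1.
by rewrite -d'E v1 mul1g.
Qed.

(** One half of Deodhar's lemma, [DJ_unlinked] being the other. As d is increasing on the block of x
    and y and takes the adjacent values k and k+1 there, x and y are adjacent points, and
    conjugation by d carries s_x to s_k. *)
Lemma DJ_linked J d k : k < m -> DJ J d ->
    linked J (d^-1%g (inord k)) (d^-1%g (inord k.+1)) ->
  [/\ d^-1%g (inord k.+1) = (d^-1%g (inord k)).+1 :> nat,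
      val (d^-1%g (inord k)) \in J, asc d^-1%g k
    & (d * sref k = sref (d^-1%g (inord k)) * d)%g].
Proof.
move=> km Dd; set x := d^-1%g (inord k); set y := d^-1%g (inord k.+1) => xy.
have dx : d x = inord k by rewrite permKV.
have dy : d y = inord k.+1 by rewrite permKV.
have k1 : d x = k :> nat by rewrite dx inordK // ltnW.
have k2 : d y = k.+1 :> nat by rewrite dy inordK.
have lt_xy : x < y.
  rewrite ltn_neqAle; apply/andP; split.
    by apply/negP => /eqP/val_inj e; move: k1; rewrite e k2; lia.
  rewrite leqNgt; apply/negP => yx.
  have := DJ_mono Dd _ yx; rewrite linked_sym xy; lia.
have yE : y = x.+1 :> nat.
  apply/eqP; rewrite eqn_leq lt_xy andbT leqNgt; apply/negP => lt2.
  have x1 : x.+1 < m.+1 := ltn_trans lt2 (ltn_ord y).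
  pose z : 'I_m.+1 := Ordinal x1.
  have xz : linked J x z by apply: linked_between xy _ _ => //=; lia.
  have zy : linked J z y by rewrite linked_sym in xz; apply: linked_trans xz xy.
  have := DJ_mono Dd xz (ltnSn x); have := DJ_mono Dd zy lt2; lia.
have xJ : val x \in J by rewrite -linkedS -yE.
split=> //.
have : (sref x ^ d = sref k)%g.
  have y' : inord x.+1 = y by rewrite -yE inord_val.
  by rewrite tpermJ inord_val y' dx dy.
by rewrite /conjg => <-; rewrite !mulgA mulgV mul1g.
Qed.

Lemma DJ_unlinked J d k : k < m -> all (fun k => k < m) J -> DJ J d ->
    ~~ linked J (d^-1%g (inord k)) (d^-1%g (inord k.+1)) ->
  DJ J (d * sref k)%g.
Proof.
move=> km mJ Dd nxy; apply/allP => j jJ; have jm := allP mJ _ jJ.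
have := allP Dd _ jJ; rewrite /asc !permM !srefE //.
set a := d (inord j); set b := d (inord j.+1) => ab.
suff : ~~ ((a == k :> nat) && (b == k.+1 :> nat)).
  by case: (eqVneq (a : nat) k); case: (eqVneq (a : nat) k.+1);
  case: (eqVneq (b : nat) k); case: (eqVneq (b : nat) k.+1); lia.
apply: contra nxy => /andP[/eqP ak /eqP bk].
have -> : inord k = a by rewrite -ak inord_val.
have -> : inord k.+1 = b by rewrite -bk inord_val.
by rewrite !permK !inordK ?linkedS // ltnW.
Qed.

Lemma linked_mul_sref J d k :
  linked J ((d * sref k)^-1%g (inord k)) ((d * sref k)^-1%g (inord k.+1)) =
  linked J (d^-1%g (inord k)) (d^-1%g (inord k.+1)).
Proof. by rewrite invMg srefV !permM sref_l sref_r linked_sym. Qed.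

End Parabolic.

Arguments linked : simpl never.

(** * Centrality of relative norms *)

Section Norms.

Local Open Scope ring_scope.

Variables (m : nat) (H : algType {poly int}) (t : 'I_m -> H).
Hypothesis Ht : @hecke_relations m.+1 H t.
Implicit Types (w u v x y d : 'S_m.+1) (k j : nat) (a g h : H).

Local Notation sref := (sref m).
Local Notation Ts := (Ts t).
Local Notation TT := (TT t).
Local Notation Tprod := (Tprod t).

Lemma TT_WD (J : seq nat) u d : all (fun k => k < m)%N J -> u \in WJ m J ->
  DJ J d -> TT (u * d)%g = TT u * TT d.
Proof. by move=> mJ uJ Dd; rewrite TT_mul // (ninv_WD mJ). Qed.

Lemma TTV_WD (J : seq nat) u d : all (fun k => k < m)%N J -> u \in WJ m J ->
  DJ J d -> TT (u * d)^-1%g = TT d^-1%g * TT u^-1%g.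
Proof.
move=> mJ uJ Dd; rewrite invMg TT_mul // -invMg !inv_invg (ninv_WD mJ) //.
by rewrite addnC.
Qed.

Lemma norm_pair_comm k a : (k < m)%N ->
  Ts k * (a + Ts k * a * Ts k) = (a + Ts k * a * Ts k) * Ts k.
Proof.
move=> km; rewrite mulrDr mulrDl !mulrA Ts_quad // -(mulrA (Ts k * a)) Ts_quad //.
by rewrite !mulrDl mulrDr mul1r mulr1 -!scalerAl -scalerAr addrCA.
Qed.

(** If s_k fixes the coset of d, the term of d commutes with T_k by itself, since T_k can be traded
    for a generator T_j with j in J, which commutes with h. The other representatives come in pairs
    d, d s_k. *)
Theorem norm_comm (J : seq nat) h : all (fun k => k < m)%N J ->
  (forall j, j \in J -> Ts j * h = h * Ts j) ->
  forall k, (k < m)%N ->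
  Ts k * (\sum_(d | DJ J d) TT d^-1%g * h * TT d) =
  (\sum_(d | DJ J d) TT d^-1%g * h * TT d) * Ts k.
Proof.
move=> mJ hJ k km; pose F d := TT d^-1%g * h * TT d; rewrite -/(F _).
pose L d := linked J (d^-1%g (inord k)) (d^-1%g (inord k.+1)).
rewrite (bigID L) /= mulrDl mulrDr; congr (_ + _).
  rewrite mulr_sumr mulr_suml; apply: eq_bigr => d /andP[Dd Ld].
  have [_ xJ ek dk] := DJ_linked km Dd Ld; set j := val _ in xJ dk.
  have ad : asc d j := allP Dd _ xJ; have jm := allP mJ _ xJ.
  have kd : (sref k * d^-1 = d^-1 * sref j)%g.
    by rewrite -(srefV _ k) -invMg dk invMg srefV.
  rewrite /F -[RHS]mulrA -(TT_ascR Ht) // dk TT_asc // !mulrA -TT_asc //.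
  by rewrite kd TT_ascR ?invgK // -(mulrA _ (Ts j)) hJ // mulrA.
(* The sum runs over the shorter member d of each pair; the longer one contributes T_k F(d) T_k, and
   a + T_k a T_k commutes with T_k by the quadratic relation. *)
suff -> : \sum_(d | DJ J d && ~~ L d) F d =
    \sum_(d | (DJ J d && ~~ L d) && asc d^-1%g k) (F d + Ts k * F d * Ts k).
  rewrite mulr_sumr mulr_suml; apply: eq_bigr => d _.
  exact: norm_pair_comm.
rewrite (bigID (fun d => asc d^-1%g k)) /= big_split /=; congr (_ + _).
rewrite (reindex_inj (mulIg (sref k))) /=; apply: eq_big => [d|d].
  rewrite /L linked_mul_sref -/(L d) invMg srefV asc_sref // negbK.
  congr (_ && _); case: (boolP (L d)) => Ld; rewrite ?andbF ?andbT //.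
  apply/idP/idP => [Dd|Dd]; last exact: DJ_unlinked.
  have := DJ_unlinked km mJ Dd; rewrite linked_mul_sref -mulgA sref2 mulg1.
  exact.
rewrite invMg srefV asc_sref // negbK => /andP[_ ad].
by rewrite /F invMg srefV TT_asc // TT_ascR // !mulrA.
Qed.

End Norms.

(** * Jucys-Murphy elements *)

Section JucysMurphy.

Local Open Scope ring_scope.

Variables (m : nat) (H : algType {poly int}) (t : 'I_m -> H).
Hypothesis Ht : @hecke_relations m.+1 H t.
Implicit Types (w u v x y d : 'S_m.+1) (k j : nat) (a g h : H)
  (P : pred 'S_m.+1).

Local Notation sref := (sref m).
Local Notation Ts := (Ts t).
Local Notation TT := (TT t).
Local Notation Tprod := (Tprod t).
Local Notation gen := (gen t).

(** A bound on the T_w that may occur in h. It is enough to make traces vanish, since tau of T_x T_y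
    is zero unless y = x^-1. *)
Definition supp (P : pred 'S_m.+1) h :=
  exists c : 'S_m.+1 -> {poly int}, h = \sum_(w | P w) c w *: TT w.

Lemma supp_TT (P : pred 'S_m.+1) w : P w -> supp P (TT w).
Proof.
move=> Pw; exists (fun v => (v == w)%:R); rewrite (bigD1 w) //= eqxx scale1r.
by rewrite big1 ?addr0 // => v /andP[_ /negPf->]; rewrite scale0r.
Qed.

Lemma supp_lin P c g h : supp P g -> supp P h -> supp P (c *: g + h).
Proof.
move=> [c1 ->] [c2 ->]; exists (fun w => c * c1 w + c2 w).
rewrite scaler_sumr -big_split /=.
by apply: eq_bigr => w _; rewrite scalerDl scalerA.
Qed.

Lemma supp0 P : supp P 0.
Proof. by exists (fun=> 0); rewrite big1 // => w _; rewrite scale0r. Qed.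

Lemma suppD P g h : supp P g -> supp P h -> supp P (g + h).
Proof. by rewrite -{2}(scale1r g); apply: supp_lin. Qed.

Lemma suppZ P c g : supp P g -> supp P (c *: g).
Proof. by move=> sg; rewrite -[_ *: _]addr0; apply: supp_lin => //; apply: supp0. Qed.

Lemma supp_ind P (Q : H -> Prop) : (forall c g h, Q g -> Q h -> Q (c *: g + h)) ->
  Q 0 -> (forall w, P w -> Q (TT w)) -> forall h, supp P h -> Q h.
Proof.
move=> Ql Q0 QT h [c ->]; elim/big_ind: _ => // [g1 g2 Q1 Q2|w Pw].
  by rewrite -(scale1r g1); apply: Ql.
by rewrite -[_ *: _]addr0; apply: Ql => //; apply: QT.
Qed.

Lemma supp_mulr P h k : (k < m)%N -> (forall w, P w -> P (w * sref k)%g) ->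
  supp P h -> supp P (h * Ts k).
Proof.
move=> km Pk; apply: (@supp_ind P (fun h => supp P (h * Ts k))) => [c g1 g2|| w Pw].
- by rewrite mulrDl -scalerAl; apply: supp_lin.
- by rewrite mul0r; apply: supp0.
case: (boolP (asc w^-1%g k)) => aw.
  by rewrite -TT_ascR //; apply/supp_TT/Pk.
by rewrite TT_descR //; apply: suppD; [|apply: suppZ]; apply: supp_TT => //; apply: Pk.
Qed.

Lemma gen_supp k g : (k <= m)%N -> gen k g ->
  supp (fun w => w \in WJ m (iota 0 k)) g.
Proof.
move=> km; elim=> [|c g1 g2 _ IH1 _ IH2|g1 j _ IH jk].
- by rewrite -(TT1 Ht); apply/supp_TT/group1.
- exact: supp_lin.
have jm := leq_trans jk km.
apply: supp_mulr => // w wJ; apply: groupM => //.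
by rewrite sref_WJ // mem_iota.
Qed.

(* The q-analogue of the sum of the transpositions (i k), for i < k in the block
   of k; it is 0 when k is the first point of its block. *)
Fixpoint JM (A : seq nat) k : H :=
  if k is k'.+1 then
    if k' \in A then Ts k' + Ts k' * JM A k' * Ts k' else 0
  else 0.

(** The first point of a block contributes the factor 1, because [JM] vanishes there. *)
Fixpoint JMprod (A : seq nat) k : H :=
  if k is k'.+1 then JMprod A k' * (if k' \in A then JM A k'.+1 else 1) else 1.

Lemma JM_comm A k h : (forall j, (j < k)%N -> j \in A -> Ts j * h = h * Ts j) ->
  JM A k * h = h * JM A k.
Proof.
elim: k => [|k IHk] hc /=; first by rewrite mulr0 mul0r.
case: ifP => kA; last by rewrite mulr0 mul0r.
have hk : Ts k * h = h * Ts k by apply: hc.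
have hM : JM A k * h = h * JM A k by apply: IHk => j jk; apply: hc; apply: ltnW.
by rewrite mulrDl mulrDr -!mulrA hk (mulrA (JM A k)) hM !mulrA hk.
Qed.

Lemma JMprod_comm A k h :
  (forall j, (j < k)%N -> j \in A -> Ts j * h = h * Ts j) ->
  JMprod A k * h = h * JMprod A k.
Proof.
elim: k => [|k IHk] hc; first by rewrite mulr1 mul1r.
have hM : JMprod A k * h = h * JMprod A k.
  by apply: IHk => j jk; apply: hc; apply: ltnW.
rewrite [JMprod A k.+1]/=; case: ifP => kA; last by rewrite mulr1.
have JMc := JM_comm hc.
by move: JMc; rewrite /= kA => JMc; rewrite -mulrA JMc mulrA hM mulrA.
Qed.

Lemma JM_far A k j : (k < j)%N -> Ts j * JM A k = JM A k * Ts j.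
Proof.
move=> kj; apply/esym; apply: JM_comm => i ik _; apply: Ts_comm => //.
exact: leq_ltn_trans ik kj.
Qed.

Lemma JMprod_far A k j : (k < j)%N -> Ts j * JMprod A k = JMprod A k * Ts j.
Proof.
move=> kj; apply/esym; apply: JMprod_comm => i ik _; apply: Ts_comm => //.
exact: leq_ltn_trans ik kj.
Qed.

(** The case k = j+2 carries the content: [JM] is unfolded twice, and both sides agree by the braid
    and quadratic relations. Beyond it, T_j commutes with the outer generator and induction
    applies. *)
Lemma JM_low A k j : (k <= m)%N -> j \in A -> (j.+1 < k)%N ->
  Ts j * JM A k = JM A k * Ts j.
Proof.
move=> + jA; elim: k => // k IHk km; rewrite ltnS leq_eqVlt.
rewrite [JM A k.+1]/=; case: ifP => kA; last by rewrite mulr0 mul0r.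
case/predU1P => [jk|jk]; last first.
  have c : Ts j * Ts k = Ts k * Ts j by rewrite Ts_comm.
  rewrite mulrDl mulrDr -!mulrA c; congr (_ + _).
  by rewrite -c !mulrA c -(mulrA (Ts k)) IHk ?mulrA // ltnW.
subst k; rewrite [JM A j.+1]/= jA; set L := JM A j.
have cL : Ts j.+1 * L = L * Ts j.+1 by rewrite JM_far.
have br := Ts_braid Ht km; have jm := ltnW km.
set a := Ts j in br *; set b := Ts j.+1 in br cL *.
have e1 : a * b * a * b = b * a + 'X *: (a * b * a).
  have -> : a * b * a * b = a * (b * a * b) by rewrite !mulrA.
  by rewrite -br !mulrA /a Ts_quad // !mulrDl mul1r -!scalerAl.
have e2 : b * a * b * a = a * b + 'X *: (a * b * a).
  by rewrite -br -mulrA /a Ts_quad // mulrDr mulr1 -scalerAr.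
have e3 : a * b * a * L * a * b = b * a * L * a * b * a.
  rewrite br -(mulrA (b * a)) cL -!mulrA; do 3 congr (_ * _).
  by rewrite !mulrA br.
by rewrite !(mulrDl, mulrDr) !mulrA e1 e2 e3 !addrA (addrC (a * b)).
Qed.

(** For the top generator T, the last two factors are M and M' = T + T M T, which commute by
    [JM_low]. Hence M M' T = M' M T = T M T + T M T M T = T M M'. *)
Lemma JMprod_low A k j : (k <= m)%N -> j \in A -> (j < k)%N ->
  Ts j * JMprod A k = JMprod A k * Ts j.
Proof.
move=> + jA; elim: k => // k IHk km; rewrite ltnS leq_eqVlt.
rewrite [JMprod A k.+1]/=; case/predU1P => [jk|jk].
  subst k; rewrite jA.
  case: j => [|j] in jA km IHk *.
    by rewrite /= mulr0 mul0r addr0 mul1r.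
  rewrite [JM A j.+1]/= [JMprod A j.+1]/=.
  have far : Ts j.+1 * JMprod A j = JMprod A j * Ts j.+1 by rewrite JMprod_far.
  case: ifP => jA'; last first.
    by rewrite mulr0 mul0r addr0 mulr1 mulrA far.
  have -> : Ts j + Ts j * JM A j * Ts j = JM A j.+1 by rewrite /= jA'.
  set T := Ts j.+1 in far *; set M := JM A j.+1; set M' := T + _.
  rewrite !mulrA far -!mulrA; congr (_ * _); rewrite /M' {M'}.
  have M2 : M * (T + T * M * T) = (T + T * M * T) * M.
    apply: JM_comm => i ij iA; have := JM_low km iA.
    rewrite [JM A j.+2]/= jA; apply; rewrite ltnS.
    by [].
  by rewrite jA' [RHS]mulrA [in RHS]M2 !mulrDr !mulrDl !mulrA.
rewrite mulrA IHk ?(ltnW km) // -[LHS]mulrA -[RHS]mulrA; congr (_ * _).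
case: ifP => kA; last by rewrite mulr1 mul1r.
have jk1 : (j.+1 < k.+1)%N by [].
by have := JM_low km jA jk1; rewrite /= kA.
Qed.

Lemma Tprod_comm L h : (forall i, i \in L -> Ts i * h = h * Ts i) ->
  h * Tprod L = Tprod L * h.
Proof.
elim: L => [|i L IHL] hL; first by rewrite Tprod_nil mulr1 mul1r.
rewrite Tprod_cons mulrA -hL ?mem_head // -!mulrA IHL // => j jL.
by apply: hL; rewrite inE jL orbT.
Qed.

(** The span of H_k T_k H_k, with H_k the subalgebra [gen k]. By [tau_mid] it is orthogonal to H_k
    under the trace form. *)
Inductive mid k : H -> Prop :=
| mid_mul g h : gen k g -> gen k h -> mid k (g * Ts k * h)
| mid_lin c g h : mid k g -> mid k h -> mid k (c *: g + h).

Lemma mid_D k g h : mid k g -> mid k h -> mid k (g + h).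
Proof. by rewrite -{2}(scale1r g); apply: mid_lin. Qed.

Lemma mid_0 k : mid k 0.
Proof.
by rewrite -[0](mul0r (Ts k)) -[_ * _]mulr1; apply: mid_mul; [apply: gen_0 | apply: gen_1].
Qed.

Lemma mid_Z k c g : mid k g -> mid k (c *: g).
Proof. by move=> kg; rewrite -[_ *: _]addr0; apply: mid_lin => //; apply: mid_0. Qed.

Lemma mid_Ts k : mid k (Ts k).
Proof. by rewrite -[Ts k]mul1r -[_ * _]mulr1; apply: mid_mul; apply: gen_1. Qed.

Lemma mid_conj A k : (k < m)%N -> mid k (Ts k * JM A k * Ts k).
Proof.
elim: k => [|k IHk] km; first by rewrite /= mulr0 mul0r; apply: mid_0.
rewrite [JM A k.+1]/=; case: ifP => _; last by rewrite mulr0 mul0r; apply: mid_0.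
have: mid k (Ts k + Ts k * JM A k * Ts k).
  by apply: mid_D; [apply: mid_Ts | apply: IHk; apply: ltnW].
elim=> [g h gk hk|c g h _ IHg _ IHh]; last first.
  by rewrite mulrDr mulrDl -scalerAr -scalerAl; apply: mid_lin.
have cg : g * Ts k.+1 = Ts k.+1 * g.
  by apply: gen_comm gk => i ik; rewrite (Ts_comm Ht).
have ch : h * Ts k.+1 = Ts k.+1 * h.
  by apply: gen_comm hk => i ik; rewrite (Ts_comm Ht).
rewrite -(mulrA _ _ (Ts k.+1)) -(mulrA _ h) ch !mulrA -cg -!mulrA.
rewrite (mulrA (Ts k)) (mulrA (Ts k.+1)) (mulrA (Ts k.+1)) -(Ts_braid Ht) //.
have -> : g * (Ts k * Ts k.+1 * Ts k * h) = g * Ts k * Ts k.+1 * (Ts k * h).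
  by rewrite !mulrA.
apply: mid_mul; first by apply: gen_mulr (gen_le _ gk) _.
by apply: hgenM; [apply: gen_Ts | apply: gen_le hk].
Qed.

Lemma gen_JM A k : gen k (JM A k).
Proof.
elim: k => [|k IHk] /=; first exact: gen_0.
case: ifP => _; last exact: gen_0.
apply: hgenD; first exact: gen_Ts.
by apply: gen_mulr => //; apply: hgenM; [apply: gen_Ts | apply: gen_le IHk].
Qed.

Lemma gen_JMprod A k : gen k (JMprod A k).
Proof.
elim: k => [|k IHk]; first exact: gen_1.
rewrite [JMprod _ _]/=; apply: hgenM; first exact: gen_le IHk.
by case: ifP => kA; [have := gen_JM A k.+1; rewrite /= kA | apply: gen_1].
Qed.

Variable tau : {scalar H}.
Hypothesis tauT : forall w, tau (TT w) = (w == 1%g)%:R.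

Lemma tau_mid k g h : (k < m)%N -> gen k g -> mid k h -> tau (g * h) = 0.
Proof.
move=> km gk; have mk (x : H) : gen k x -> gen m x by apply: gen_le; apply: ltnW.
elim=> [h1 h2 k1 k2|c h1 h2 _ IH1 _ IH2]; last first.
  by rewrite mulrDr -scalerAr linearP /= IH1 IH2 mulr0 addr0.
rewrite !mulrA (tauC Ht tauT); last exact: mk.
2: by apply: gen_mulr => //; apply: hgenM; apply: mk.
rewrite !mulrA; have : gen k (h2 * g * h1) by do !apply: hgenM => //.
move/(gen_supp (ltnW km)); move: (h2 * g * h1).
apply: (@supp_ind _ (fun a => tau (a * Ts k) = 0)) => [c x y hx hy||w wJ].
- by rewrite mulrDl -scalerAl linearP /= hx hy mulr0 addr0.
- by rewrite mul0r linear0.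
have -> : Ts k = TT (sref k).
  by rewrite -[sref k]mulg1 TT_asc ?TT1 ?mulr1 // /asc !perm1 !inordK // ltnW.
rewrite (tau_TT2 Ht tauT) -eq_invg_mul.
suff /negPf-> : w^-1%g != sref k by [].
apply: contraL wJ => /eqP wk.
by rewrite -groupV /= wk sref_WJ // mem_iota /= add0n ltnn.
Qed.

(** Induction on the top generator. If k is in A but not in L, the last factor of [JMprod] lies in
    [mid k] and the trace vanishes; if k is in L, its letter can be brought next to that factor, and
    their product is 1 modulo [mid k]. The order of L is left free because the words produced by
    [path_trace] need not be increasing. *)
Lemma tau_JMprod A k L : (k <= m)%N -> uniq L ->
  all (fun j => (j < k)%N && (j \in A)) L ->
  tau (JMprod A k * Tprod L) = (all (fun j => (j \in A) ==> (j \in L)) (iota 0 k))%:R.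
Proof.
elim: k L => [|k IHk] L km uL.
  move=> aL; case: L aL {uL} => [|//] _; rewrite Tprod_nil mulr1 /= -(TT1 Ht) tauT eqxx.
  by [].
have -> : iota 0 k.+1 = iota 0 k ++ [:: k] by rewrite -addn1 iotaD.
rewrite all_cat [all _ [:: k]]/= andbT => aL; have km' := ltnW km.
have gE := gen_JMprod A k.
have aL' L' : k \notin L' -> {subset L' <= L} ->
    all (fun j => (j < k)%N && (j \in A)) L'.
  move=> kL sL; apply/allP => j jL; have /andP[] := allP aL _ (sL _ jL).
  rewrite ltnS leq_eqVlt => /predU1P[jk|-> -> //].
  by move: kL; rewrite -jk jL.
have gtp L' : all (fun j => (j < k)%N && (j \in A)) L' -> gen k (Tprod L').
  by move=> aL1; apply: gen_Tprod; apply: sub_all aL1 => j /andP[].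
have EM1 : JMprod A k.+1 = JMprod A k * (if k \in A then JM A k.+1 else 1) by [].
rewrite EM1 [JM A k.+1]/= => {EM1}; case: ifP => kA; last first.
  have kL : k \notin L.
    by apply/negP => kL; have /andP[_] := allP aL _ kL; rewrite kA.
  by rewrite mulr1 andbT IHk //; apply: aL'.
have midM : mid k (Ts k + Ts k * JM A k * Ts k).
  by apply: mid_D; [apply: mid_Ts | apply: mid_conj].
rewrite kA implyTb; case: (boolP (k \in L)) => kL; last first.
  rewrite andbF -mulrA.
  have mg (x : H) : gen k x -> gen m x by apply: gen_le.
  have gL : gen k (Tprod L) by apply/gtp/aL'.
  have gM : gen m (Ts k + Ts k * JM A k * Ts k).
    have := gen_JM A k.+1; rewrite /= kA; exact: gen_le.
  move: midM gM; set M := Ts k + _ => midM gM.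
  rewrite (tauC Ht tauT); [|exact: mg|exact: (hgenM gM (mg _ gL))].
  rewrite -mulrA (tauC Ht tauT) //; last by apply: hgenM; apply: mg.
  by rewrite (tau_mid km) //; apply: hgenM.
rewrite andbT; set E := JMprod A k in gE IHk *.
have EM : E * (Ts k + Ts k * JM A k * Ts k) = JMprod A k.+1 by rewrite /= kA.
have ME : JM A k.+1 = Ts k + Ts k * JM A k * Ts k by rewrite /= kA.
have Lsplit := splitPr kL; move: uL aL aL'; case: L / Lsplit kL => L1 L2 kL uL aL aL'.
pose L' := L2 ++ L1.
have permL : perm_eq (L1 ++ k :: L2) (k :: L').
  by rewrite perm_catC /= perm_cons.
have uL' : uniq (k :: L') by rewrite -(perm_uniq permL).
have sL' : {subset L' <= L1 ++ k :: L2}.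
  by move=> j jL; rewrite (perm_mem permL) inE jL orbT.
have kL' : k \notin L' by case/andP: uL'.
have aL1 : all (fun j => (j < k)%N && (j \in A)) L' by apply: aL'.
(* Cyclicity of tau, with the commutation of [JMprod A k.+1] with the letters after k, rotates the
   word so that T_k comes last. The last factor [JM A k.+1] then passes over the remaining letters
   to meet it. *)
have -> : tau (E * (Ts k + Ts k * JM A k * Ts k) * Tprod (L1 ++ k :: L2)) =
    tau (E * Tprod L' * ((Ts k + Ts k * JM A k * Ts k) * Ts k)).
  have comL L3 : {subset L3 <= L'} ->
      JMprod A k.+1 * Tprod L3 = Tprod L3 * JMprod A k.+1.
    move=> s3; apply: Tprod_comm => i /s3 iL; have /andP[ik iA] := allP aL1 i iL.
    exact: (JMprod_low km iA (ltnW ik)).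
  have comM : JM A k.+1 * Tprod L' = Tprod L' * JM A k.+1.
    apply: Tprod_comm => i iL; have /andP[ik iA] := allP aL1 i iL.
    exact: (JM_low km iA).
  rewrite EM Tprod_cat Tprod_cons; have gL2 : gen m (Tprod L2).
    apply/gen_Tprod/allP => j jL; have jL' : j \in L' by rewrite mem_cat jL.
    by have /andP[jk _] := allP aL1 j jL'; apply: ltn_trans jk km.
  have gL1 : gen m (Tprod L1).
    apply/gen_Tprod/allP => j jL; have jL' : j \in L' by rewrite mem_cat jL orbT.
    by have /andP[jk _] := allP aL1 j jL'; apply: ltn_trans jk km.
  have gE1 : gen m (JMprod A k.+1) := gen_le km (gen_JMprod A k.+1).
  move: (JMprod A k.+1) EM comL gE1 => J EM comL gE1.
  rewrite !mulrA (tauC Ht tauT) //; last first.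
    by apply: gen_mulr => //; apply: hgenM.
  rewrite !mulrA -comL; last by move=> j jL; rewrite mem_cat jL.
  rewrite -(mulrA _ (Tprod L2)) -Tprod_cat -/L' -EM -ME -[in LHS](mulrA E) comM.
  by rewrite !mulrA.
have -> : (Ts k + Ts k * JM A k * Ts k) * Ts k =
    1 + ('X *: (Ts k + Ts k * JM A k * Ts k) + Ts k * JM A k).
  rewrite mulrDl -(mulrA (Ts k * _)) Ts_quad // mulrDr mulr1 -scalerAr.
  by rewrite scalerDr -!addrA; congr (_ + (_ + _)); rewrite addrC.
have gEL : gen k (E * Tprod L') by apply: hgenM => //; apply: gtp.
rewrite mulrDr mulr1 linearD /= (tau_mid km gEL) ?addr0; last first.
  apply: mid_D; first exact: mid_Z.
  rewrite -[Ts k]mul1r; apply: mid_mul; [exact: gen_1|exact: gen_JM].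
rewrite IHk //; last by case/andP: uL'.
congr (_%:R); congr nat_of_bool; apply: eq_in_all => j; rewrite mem_iota => /= jk.
rewrite (perm_mem permL) inE; congr (_ ==> _).
by rewrite ltn_eqF.
Qed.

End JucysMurphy.

(** * Cosets of the stabilizer of the top point *)

Section DescendingCycles.

Variable m : nat.
Implicit Types (u w d : 'S_m.+1) (x : 'I_m.+1) (j k : nat).

(** The cycle sending k to j and raising the points j, ..., k-1 by one. Its reduced word is s_(k-1)
    ... s_j. *)
Definition dcyc k j : 'S_m.+1 := sprod m (rev (iota j (k - j))).

Lemma iota_cat_top k j : j <= k -> iota j (k.+1 - j) = iota j (k - j) ++ [:: k].
Proof. by move=> jk; rewrite subSn // -addn1 iotaD /= subnKC. Qed.

Lemma rev_iotaS k j : j <= k -> rev (iota j (k.+1 - j)) = k :: rev (iota j (k - j)).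
Proof. by move=> jk; rewrite iota_cat_top // rev_cat. Qed.

Lemma dcycS k j : j <= k -> dcyc k.+1 j = (sref m k * dcyc k j)%g.
Proof. by move=> jk; rewrite /dcyc rev_iotaS // sprod_cons. Qed.

Lemma dcyc_id k : dcyc k k = 1%g.
Proof. by rewrite /dcyc subnn /sprod big_nil. Qed.

Lemma dcycE k j x : j <= k -> k <= m ->
  dcyc k j x = (if x < j then x : nat else if x < k then x.+1
                else if x == k :> nat then j else x) :> nat.
Proof.
elim: k x => [|k IHk] x.
  rewrite leqn0 => /eqP -> _; rewrite dcyc_id perm1; do !case: ifP; lia.
rewrite leq_eqVlt => /predU1P[-> _|jk km].
  rewrite dcyc_id perm1; do !case: ifP; lia.
rewrite dcycS // permM IHk // ?srefE //; last exact: ltnW.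
move: (val x) => a; case: (eqVneq a k) => [->|ak]; [|case: (eqVneq a k.+1) => [->|ak1]];
  do !case: ifP; lia.
Qed.

Lemma dcyc_asc k j i : j <= k -> k <= m -> i < m -> i.+1 != k -> asc (dcyc k j) i.
Proof.
move=> jk km im ik; rewrite /asc !dcycE // !inordK //; last exact: ltnW.
do !case: ifP; lia.
Qed.

Lemma eq_WJ (U V : seq nat) : U =i V -> WJ m U = WJ m V.
Proof.
move=> UV; apply/setP => u; rewrite !inE; apply: eq_forallb => x.
exact: eq_all.
Qed.

Lemma sprod_WJ U r : all (fun k => k < m) r -> {subset r <= U} -> sprod m r \in WJ m U.
Proof.
elim: r => [|k r IHr] /=; first by rewrite /sprod big_nil group1.
case/andP => km mr rU; rewrite sprod_cons groupM ?sref_WJ ?rU ?mem_head // IHr //.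
by move=> i ir; rewrite rU // inE ir orbT.
Qed.

Lemma WJ_top U k u : k <= m -> all (fun i => i < k) U ->
  ((u \in WJ m U) && (u (inord k) == inord k)) =
  (u \in WJ m [seq i <- U | i.+1 < k]).
Proof.
move=> km /allP Uk; have kE : (inord k : 'I_m.+1) = k :> nat by rewrite inordK.
have kU : k \notin U by apply/negP => /Uk; rewrite ltnn.
apply/andP/idP => [[/WJP uU /eqP uk]|/WJP uU].
  apply/WJP => x; apply/linkedP => i; rewrite mem_filter negb_and => hi.
  have [iU|iU] := boolP (i \in U); last by have /linkedP/(_ i iU) := uU x.
  move: hi; rewrite iU orbF => hi; have := Uk _ iU => ik.
  have /linkedP/(_ k kU) := uU x.
  have : (u x == k :> nat) = (x == k :> nat).
    by rewrite -kE !val_eqE -{1}uk (inj_eq perm_inj).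
  lia.
split; last first.
  have /linkedP h := uU (inord k); apply/eqP/val_inj; rewrite /= kE.
  have := h k; rewrite mem_filter negb_and kU orbT kE leqnn => /(_ isT).
  case: k => [|k] in km Uk kE kU h uU *; first lia.
  have := h k; rewrite mem_filter ltnn kE => /(_ isT); lia.
apply/WJP => x; apply: sub_all (uU x) => i; rewrite mem_filter.
by case/andP.
Qed.

(** The stabilizer of k in [WJ U] is again parabolic, by [WJ_top]. Its cosets are indexed by the
    image j of k, which ranges over the points of the block of k up to k. *)
Lemma big_WJ_top (R : nmodType) (F : 'S_m.+1 -> R) U k :
    k <= m -> all (fun i => i < k) U ->
  (\sum_(u in WJ m U) F u =
   \sum_(j < k.+1 | linked U j k)
     \sum_(u in WJ m [seq i <- U | (i.+1 < k)%N]) F (u * dcyc k j)%g)%R.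
Proof.
move=> km Uk; have kE : (inord k : 'I_m.+1) = k :> nat by rewrite inordK.
have kU : k \notin U by apply/negP => /(allP Uk); rewrite ltnn.
have uk u : u \in WJ m U -> linked U (u (inord k)) k /\ u (inord k) <= k.
  move=> /WJP/(_ (inord k)); rewrite kE => h; split=> //.
  by move/linkedP/(_ k kU): h; rewrite leqnn => ->.
rewrite (partition_big (fun u => inord (u (inord k)) : 'I_k.+1)
           (fun j : 'I_k.+1 => linked U j k)) /=; last first.
  by move=> u /uk[h1 h2]; rewrite inordK.
apply: eq_bigr => j jU.
have jk : j <= k by rewrite -ltnS.
have dU : dcyc k j \in WJ m U.
  apply: sprod_WJ; last first.
    move=> i; rewrite mem_rev => hi; move/allP: jU; apply; move: hi.
    by rewrite !mem_iota; lia.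
  apply/allP => i; rewrite mem_rev mem_iota; lia.
rewrite (reindex_inj (mulIg (dcyc k j))) /=; apply: eq_bigl => u.
rewrite -WJ_top // groupMr //; apply: andb_id2l => uU.
have [_ le] : linked U ((u * dcyc k j)%g (inord k)) k /\
    (u * dcyc k j)%g (inord k) <= k by apply: uk; rewrite groupM.
rewrite -val_eqE /= inordK // permM.
have dk : dcyc k j (inord k) = j :> nat.
  by rewrite dcycE // kE; do !case: ifP; lia.
by rewrite -(inj_eq (@perm_inj _ (dcyc k j))) -[RHS]val_eqE /= dk.
Qed.

End DescendingCycles.

(** * The element eta as a product of Jucys-Murphy elements *)

Section Eta.

Local Open Scope ring_scope.

Variables (m : nat) (H : algType {poly int}) (t : 'I_m -> H).
Hypothesis Ht : @hecke_relations m.+1 H t.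
Implicit Types (w u v x y d : 'S_m.+1) (k j : nat) (a g h : H).

Local Notation sref := (sref m).
Local Notation Ts := (Ts t).
Local Notation TT := (TT t).
Local Notation Tprod := (Tprod t).

Lemma TT_dcyc k j : (j <= k)%N -> (k <= m)%N ->
  TT (dcyc m k j) = Tprod (rev (iota j (k - j))).
Proof.
elim: k => [|k IHk].
  by rewrite leqn0 => /eqP-> _; rewrite dcyc_id subnn TT1 // Tprod_nil.
rewrite leq_eqVlt => /predU1P[-> _|jk km].
  by rewrite dcyc_id subnn TT1 // Tprod_nil.
have km' := ltnW km.
rewrite dcycS // rev_iotaS // Tprod_cons TT_asc ?IHk //.
by apply: dcyc_asc => //; rewrite gtn_eqF.
Qed.

Lemma TT_dcycV k j : (j <= k)%N -> (k <= m)%N ->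
  TT (dcyc m k j)^-1%g = Tprod (iota j (k - j)).
Proof.
elim: k => [|k IHk].
  by rewrite leqn0 => /eqP-> _; rewrite dcyc_id invg1 subnn TT1 // Tprod_nil.
rewrite leq_eqVlt => /predU1P[-> _|jk km].
  by rewrite dcyc_id invg1 subnn TT1 // Tprod_nil.
have km' := ltnW km.
rewrite dcycS // invMg srefV TT_ascR ?invgK ?IHk //.
  by rewrite iota_cat_top // Tprod_cat Tprod_seq1.
by apply: dcyc_asc => //; rewrite gtn_eqF.
Qed.

(** The recursion for [JM] builds each transposition by conjugation from outside, whereas coset
    representatives conjugate T_k from inside. Braid relations pass from one reduced word of the
    transposition (j k+1) to the other. *)
Lemma JM_sum A k : (k < m)%N -> k \in A ->
  JM t A k.+1 = \sum_(j < k.+1 | linked A j k)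
    Tprod (iota j (k - j)) * Ts k * Tprod (rev (iota j (k - j))).
Proof.
elim: k => [|k IHk] km kA.
  rewrite big_mkcond big_ord1 /= kA.
  by rewrite mulr0 mul0r addr0 Tprod_nil mulr1 mul1r.
rewrite big_mkcond big_ord_recr /= linked_refl subnn Tprod_nil mulr1 mul1r.
rewrite kA addrC; congr (_ + _); rewrite -big_mkcond /=.
have linkA (j : 'I_k.+1) : linked A j k.+1 = linked A j k && (k \in A).
  apply/idP/andP => [jk|[jk k1]].
    have jk1 : linked A j k by apply: linked_between jk _ _ => //; rewrite -ltnS.
    split=> //; rewrite -linkedS; apply: linked_trans jk.
    by rewrite linked_sym.
  by apply: linked_trans jk _; rewrite linkedS.
under eq_bigl => j do rewrite linkA.
case: (boolP (k \in A)) => k1; last first.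
  rewrite big1 => [|j]; last by rewrite andbF.
  by rewrite mulr0 mul0r.
have := IHk (ltnW km) k1; rewrite /= k1 => ->.
rewrite mulr_sumr mulr_suml; apply: eq_big => [j|j jk]; first by rewrite andbT.
have lejk : (j <= k)%N by rewrite -ltnS.
rewrite rev_iotaS // Tprod_cons iota_cat_top // Tprod_cat Tprod_seq1.
have com r : all (fun i => (i < k)%N) r -> Ts k.+1 * Tprod r = Tprod r * Ts k.+1.
  move/allP => rk; apply: Tprod_comm => i /rk ik.
  by rewrite (Ts_comm Ht).
have c1 : Ts k.+1 * Tprod (iota j (k - j)) = Tprod (iota j (k - j)) * Ts k.+1.
  by apply/com/allP => i; rewrite mem_iota; lia.
have c2 : Ts k.+1 * Tprod (rev (iota j (k - j))) = Tprod (rev (iota j (k - j))) * Ts k.+1.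
  by apply/com/allP => i; rewrite mem_rev mem_iota; lia.
rewrite !mulrA c1 -!mulrA -c2 !mulrA.
by congr (_ * _); rewrite -!mulrA; congr (_ * _); rewrite !mulrA (Ts_braid Ht).
Qed.

Lemma TT_WJ_far (U : seq nat) k u : (k < m)%N -> all (fun i => i.+1 < k)%N U -> u \in WJ m U ->
  Ts k * TT u = TT u * Ts k.
Proof.
move=> km /allP Uk; elim/WJ_ind => [|v i im iU av vU IHv].
  by rewrite TT1 // mulr1 mul1r.
by rewrite TT_asc // mulrA -(Ts_comm Ht) ?Uk // -!mulrA IHv.
Qed.

(** For A the generators of S_lambda, these are the generators of S_(lambda-1) of index below k-1:
    detaching the last point of a block removes its last generator. *)
Definition drop_ends (A : seq nat) k : seq nat :=
  [seq i <- iota 0 k.-1 | (i \in A) && (i.+1 \in A)].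

(* A coset of the parabolic subgroup of drop_ends A k in that of
   drop_ends A k.+1 is represented by a cycle dcyc k j, and the conjugates of
   Ts k by these cycles sum to JM A k.+1. *)
Theorem eta_JMprod A k : (k <= m)%N ->
  \sum_(u in WJ m (drop_ends A k))
    TT u^-1%g * Tprod [seq i <- iota 0 k | i \in A] * TT u = JMprod t A k.
Proof.
elim: k => [|k IHk] km.
  rewrite /drop_ends /= Tprod_nil.
  have -> : WJ m [::] = 1%g.
    apply/setP => u; rewrite !inE; apply/forallP/eqP => [h|-> x].
      apply/permP => x; rewrite perm1; apply/val_inj/eqP; have /linkedP h' := h x.
      by rewrite eqn_leq (h' x isT) -(h' (u x) isT) !leqnn.
    by rewrite perm1 linked_refl.
  by rewrite big_set1 invg1 !TT1 // !mulr1.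
have -> : iota 0 k.+1 = iota 0 k ++ [:: k] by rewrite -addn1 iotaD.
rewrite filter_cat Tprod_cat [JMprod _ _ _]/=.
case: (boolP (k \in A)) => kA; last first.
  rewrite /= (negPf kA) Tprod_nil !mulr1 -IHk; last exact: ltnW.
  rewrite (@eq_WJ m (drop_ends A k.+1) (drop_ends A k)) // => i.
  rewrite !mem_filter !mem_iota /=.
  case: (eqVneq i.+1 k) => [->|]; first by rewrite (negPf kA) andbF.
  by move=> ik; congr (_ && _); lia.
rewrite [filter _ [:: k]]/= kA Tprod_seq1.
have kU : all (fun i => i < k)%N (drop_ends A k.+1).
  by apply/allP => i; rewrite mem_filter mem_iota; lia.
rewrite (big_WJ_top _ (ltnW km) kU).
have UE : [seq i <- drop_ends A k.+1 | (i.+1 < k)%N] =i drop_ends A k.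
  by move=> i; rewrite !mem_filter !mem_iota; lia.
rewrite (eq_WJ m UE).
have Uk : all (fun i => i.+1 < k)%N (drop_ends A k).
  by apply/allP => i; rewrite mem_filter mem_iota; lia.
have Um : all (fun i => i < m)%N (drop_ends A k).
  by apply: sub_all Uk => i; lia.
have -> : Ts k + Ts k * JM t A k * Ts k = JM t A k.+1 by rewrite /= kA.
rewrite JM_sum // mulr_sumr; apply: eq_big => [j|j jk].
  have jk : (j <= k)%N by rewrite -ltnS.
  apply/allP/allP => h i hi; first by have := h i hi; rewrite mem_filter => /andP[/andP[]].
  have i1 : i.+1 \in A.
    case: (eqVneq i.+1 k) => [->//|ik]; apply: h; move: hi; rewrite !mem_iota; lia.
  by rewrite mem_filter h // i1 mem_iota; move: hi; rewrite mem_iota; lia.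
have lejk : (j <= k)%N by rewrite -ltnS.
have kU' : k \notin drop_ends A k.+1 by apply/negP => /(allP kU); rewrite ltnn.
have jA : linked A j k.
  by apply: sub_all jk => i; rewrite mem_filter => /andP[/andP[]].
have comJ r : {subset r <= iota j (k - j)} ->
    JMprod t A k * Tprod r = Tprod r * JMprod t A k.
  move=> rj; apply: Tprod_comm => i /rj iij.
  have ik : (i < k)%N by move: iij; rewrite mem_iota; lia.
  apply: JMprod_low => //; first exact: ltnW.
  by move/allP: jA; apply; move: iij; rewrite !mem_iota; lia.
have Dd : DJ (drop_ends A k) (dcyc m k j).
  apply/allP => i iU; have := allP Uk _ iU => ik.
  by apply: dcyc_asc => //; [exact: ltnW | exact: (allP Um) | rewrite ltn_eqF].
(* The inner sum over u gives [JMprod A k]. It commutes with the cycle word, so only T_k is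
   conjugated by the cycle. *)
rewrite !mulrA comJ // -IHk; last exact: ltnW.
rewrite mulr_sumr !mulr_suml; apply: eq_bigr => u uU.
rewrite (TT_WD Ht Um uU Dd) (TTV_WD Ht Um uU Dd) TT_dcycV ?TT_dcyc ?(ltnW km) //.
rewrite -!mulrA; do 3 congr (_ * _).
by rewrite !mulrA (TT_WJ_far km Uk uU).
Qed.

End Eta.

(** * The trace of the norm basis on Coxeter elements *)

Section TraceOfNorm.

Local Open Scope ring_scope.

Variables (m : nat) (H : algType {poly int}) (t : 'I_m -> H).
Hypothesis Ht : @hecke_relations m.+1 H t.
Variable tau : {scalar H}.
Hypothesis tauT : forall w, tau (TT t w) = (w == 1%g)%:R.
Variable A : seq nat.
Hypothesis mA : all (fun k => k < m)%N A.
Implicit Types (w u v x y d : 'S_m.+1) (k j : nat) (a g h : H) (J : seq nat).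

Local Notation sref := (sref m).
Local Notation Ts := (Ts t).
Local Notation TT := (TT t).
Local Notation Tprod := (Tprod t).
Local Notation supp := (supp t).
Local Notation suppA := (supp (fun w => w \in WJ m A)).

Lemma suppA_Ts h k : k \in A -> suppA h -> suppA (h * Ts k).
Proof.
move=> kA; have km := allP mA _ kA; apply: supp_mulr => // w wA.
by rewrite groupM ?sref_WJ.
Qed.

Lemma suppA_1 : suppA 1.
Proof. by rewrite -(TT1 Ht); apply/supp_TT/group1. Qed.

Lemma suppA_mul g h : suppA g -> suppA h -> suppA (g * h).
Proof.
move=> sg; apply: (@supp_ind _ _ _ _ (fun h => suppA (g * h))) => [c h1 h2||w wA].
- by rewrite mulrDr -scalerAr; apply: supp_lin.
- by rewrite mulr0; apply: supp0.
elim/WJ_ind: wA g sg => [|u k km kA au uA IHu] g sg; first by rewrite TT1 // mulr1.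
by rewrite TT_asc // mulrA; apply: IHu; apply: suppA_Ts.
Qed.

Lemma suppA_JM k : suppA (JM t A k).
Proof.
elim: k => [|k IHk] /=; first exact: supp0.
case: ifP => kA; last exact: supp0.
have sk : suppA (Ts k) by rewrite -[Ts k]mul1r; apply: suppA_Ts (suppA_1).
by apply: suppD => //; apply: suppA_mul => //; apply: suppA_mul.
Qed.

Lemma suppA_JMprod k : suppA (JMprod t A k).
Proof.
elim: k => [|k IHk]; first exact: suppA_1.
rewrite [JMprod _ _ _]/=; apply: suppA_mul => //.
by case: ifP => kA; [have := suppA_JM k.+1; rewrite /= kA | apply: suppA_1].
Qed.

(** For d increasing on the blocks of A, this says that right multiplication by s_j fixes the coset
    of d; the two cases are [DJ_linked] and [DJ_unlinked]. *)
Definition stays d j :=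
  linked A (d^-1%g (inord j)) (d^-1%g (inord j.+1)).

(* The block occupying j has changed from d to d * sref j, and the generators of
   J, all of index greater than j, never move it back. *)
Lemma moved_trace0 d j J h : (j < m)%N -> DJ A d -> ~~ stays d j ->
  all (fun k => j < k < m)%N J -> suppA h ->
  tau (h * TT (d * sref j)%g * Tprod J * TT d^-1%g) = 0.
Proof.
move=> jm Dd nj; pose P w := ~~ linked A (w^-1%g (inord j)) (d^-1%g (inord j)).
have Dj : DJ A (d * sref j)%g by apply: DJ_unlinked.
have PT (g : H) : supp P g -> tau (g * TT d^-1%g) = 0.
  apply: (@supp_ind _ _ _ _ (fun g => tau (g * TT d^-1%g) = 0)) => [c g1 g2 h1 h2||w Pw].
  - by rewrite mulrDl -scalerAl linearP /= h1 h2 mulr0 addr0.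
  - by rewrite mul0r linear0.
  rewrite (tau_TT2 Ht tauT) -eq_mulgV1; case: eqP Pw => // -> /negP[].
  exact: linked_refl.
have P0 : suppA h -> supp P (h * TT (d * sref j)%g).
  apply: (@supp_ind _ _ _ _ (fun h => supp P (h * TT (d * sref j)%g))) => [c g1 g2||w wA].
  - by rewrite mulrDl -scalerAl; apply: supp_lin.
  - by rewrite mul0r; apply: supp0.
  rewrite -(TT_WD Ht mA) //; apply: supp_TT; rewrite /P !invMg srefV !permM sref_l.
  apply: contra nj; rewrite /stays linked_sym => h1.
  apply: linked_trans h1 _; have /WJP := groupVr wA; apply.
move=> aJ /P0 sP; apply: PT; elim/last_ind: J aJ => [|J k IHJ].
  by rewrite Tprod_nil mulr1.
rewrite all_rcons => /andP[/andP[jk km] /IHJ {}IHJ].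
rewrite -cats1 Tprod_cat Tprod_seq1 mulrA; apply: supp_mulr => // w.
rewrite /P invMg srefV permM sref_inord_id //; lia.
Qed.

(** For the first letter j of J, T_d T_j is T_x T_d if j stays (x being the preimage of j under d),
    T_(d s_j) if s_j lengthens d, and T_(d s_j) + xi T_d otherwise. The terms T_(d s_j) are killed
    by [moved_trace0], and h accumulates the letters T_x. *)
Lemma path_trace d J h : DJ A d -> increasing_word m J -> suppA h ->
  tau (h * TT d * Tprod J * TT d^-1%g) =
  if all (fun j => stays d j || ~~ asc d^-1%g j) J then
    'X^(count (fun j => ~~ stays d j) J) *
    tau (h * Tprod [seq val (d^-1%g (inord j : 'I_m.+1)) | j <- J & stays d j])
  else 0.
Proof.
move=> Dd; elim: J h => [|j J IHJ] h incJ sh.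
  rewrite /= !Tprod_nil !mulr1 mul1r; move: h sh.
  apply: (@supp_ind _ _ _ _ (fun h => tau (h * TT d * TT d^-1%g) = tau h)) => [c g1 g2 h1 h2||w wA].
  - by rewrite !mulrDl -!scalerAl !linearP /= h1 h2.
  - by rewrite !mul0r linear0.
  by rewrite -(TT_WD Ht mA) // (tau_TT2 Ht tauT) mulgK tauT.
have /andP[] := incJ; rewrite /= (path_sortedE ltn_trans).
move=> /andP[jJ sJ] /andP[jm mJ].
have incJ' : increasing_word m J by rewrite /increasing_word sJ.
have jJm : all (fun k => j < k < m)%N J.
  by apply/allP => k kJ; rewrite (allP jJ) // (allP mJ).
rewrite Tprod_cons !mulrA; case: (boolP (stays d j)) => sj /=.
  have [_ xA aj dj] := DJ_linked jm Dd sj; have xm := allP mA _ xA.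
  rewrite -(mulrA h) -TT_ascR // dj TT_asc ?(allP Dd) // mulrA.
  rewrite IHJ //; last exact: suppA_Ts.
  rewrite Tprod_cons add0n; case: ifP => // _.
  by rewrite mulrA.
case: (boolP (asc d^-1%g j)) => aj /=.
  by rewrite -(mulrA h) -TT_ascR // moved_trace0.
rewrite -(mulrA h) TT_descR // mulrDr !mulrDl linearD /= moved_trace0 // add0r.
rewrite -scalerAr -!scalerAl linearZ /= IHJ //; case: ifP => _.
  by rewrite add1n exprS mulrA.
by rewrite mulr0.
Qed.

Definition block_reps J : {set 'S_m.+1} :=
  [set d | [&& DJ A d, all (fun j => stays d j || ~~ asc d^-1%g j) J &
    all (fun i => i \in [seq val (d^-1%g (inord j : 'I_m.+1)) | j <- J & stays d j]) A]].

(** For d in [block_reps] the staying letters of J correspond one to one to the elements of A, so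
    each such d contributes the same power of xi; there is no such d when J is shorter than A. *)
Theorem tau_norm J : uniq A -> increasing_word m J ->
  tau ((\sum_(d | DJ A d) TT d^-1%g * JMprod t A m * TT d) * Tprod J) =
  if (size A <= size J)%N then #|block_reps J|%:R * 'X^(size J - size A) else 0.
Proof.
move=> uA incJ; have /andP[sJ mJ] := incJ.
have uJ : uniq J by apply: sorted_uniq sJ; [exact: ltn_trans | exact: ltnn].
pose L d := [seq val (d^-1%g (inord j : 'I_m.+1)) | j <- J & stays d j].
have uL d : uniq (L d).
  rewrite map_inj_in_uniq ?filter_uniq // => i j.
  rewrite !mem_filter => /andP[_ /(allP mJ) im] /andP[_ /(allP mJ) jm].
  by move=> /val_inj/perm_inj/(congr1 val); rewrite /= !inordK // ltnS ltnW.
have aL d : DJ A d -> all (fun j => (j < m) && (j \in A))%N (L d).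
  move=> Dd; apply/allP => i /mapP[j].
  rewrite mem_filter => /andP[sj /(allP mJ) jm] ->.
  by have [_ xA _ _] := DJ_linked jm Dd sj; rewrite xA (allP mA _ xA).
have szL d : d \in block_reps J ->
    size J = (count (fun j => ~~ stays d j) J + size A)%N.
  rewrite inE => /and3P[Dd _ /allP AL]; have -> : size A = size (L d).
    apply/perm_size/uniq_perm => // i; apply/idP/idP => [/AL //|iL].
    by have /andP[_ ->] := allP (aL d Dd) i iL.
  by rewrite size_map size_filter addnC; apply/esym/count_predC.
have gT w : gen t m (TT w) := gen_TT Ht w.
have gtp : gen t m (Tprod J) by apply: gen_Tprod.
have gE : gen t m (JMprod t A m) := gen_JMprod t A m.
transitivity (\sum_(d in block_reps J) 'X^(size J - size A) : {poly int}).
  rewrite mulr_suml linear_sum /= big_mkcond [RHS]big_mkcond /=.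
  apply: eq_bigr => d _; case: ifP => Dd; last by rewrite inE Dd.
  have -> : tau (TT d^-1%g * JMprod t A m * TT d * Tprod J) =
      tau (JMprod t A m * TT d * Tprod J * TT d^-1%g).
    rewrite -!mulrA (tauC Ht tauT) //; last by do !apply: hgenM.
    by rewrite !mulrA.
  rewrite path_trace //; last exact: suppA_JMprod.
  rewrite (tau_JMprod Ht tauT (leqnn m) (uL d) (aL d Dd)).
  have -> : all (fun j => (j \in A) ==> (j \in L d)) (iota 0 m) =
      all (fun i => i \in L d) A.
    apply/allP/allP => h i hi.
      by have := h i; rewrite mem_iota (allP mA _ hi) hi; apply.
    by apply/implyP => /h.
  case: (boolP (d \in block_reps J)) => dX.
    rewrite (szL d dX) addnK; move: dX; rewrite inE => /and3P[_ -> ->].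
    by rewrite mulr1.
  move: dX; rewrite inE Dd /=; case: ifP => //= _ /negPf->.
  by rewrite mulr0.
rewrite sumr_const; case: leqP => le; first by rewrite mulr_natl.
have -> : block_reps J = set0; last by rewrite cards0.
apply/setP => d; rewrite [RHS]inE; apply/negP => /szL; lia.
Qed.

End TraceOfNorm.

(** * Permutation characters *)

Section BlockOrder.

Variables (m : nat) (A : seq nat).
Implicit Types (x y z : 'I_m.+1).

(* Larger blocks come first, and each block keeps its increasing order. *)
Definition prec x y := if linked A x y then x < y else y < x.

Lemma prec_irr x : ~~ prec x x.
Proof. by rewrite /prec linked_refl ltnn. Qed.

Lemma prec_total x y : x != y -> prec x y || prec y x.
Proof.
by rewrite /prec linked_sym -val_eqE neq_ltn => /orP[] h; case: ifP; rewrite h ?orbT.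
Qed.

Lemma prec_trans : transitive prec.
Proof.
move=> y x z; rewrite /prec.
have btw (a b c : nat) : linked A a c -> a <= b -> b <= c -> linked A a b.
  exact: linked_between.
have [h1|h1] := boolP (linked A x y); have [h2|h2] := boolP (linked A y z).
- rewrite (linked_trans h1 h2); exact: ltn_trans.
- have /negPf-> : ~~ linked A x z.
    by apply: contra h2 => h3; apply: linked_trans h3; rewrite linked_sym.
  move=> xy zy; rewrite ltnNge; apply: contra h2 => xz.
  rewrite linked_sym; apply: linked_trans (h1); rewrite linked_sym.
  exact: btw h1 xz (ltnW zy).
- have /negPf-> : ~~ linked A x z.
    by apply: contra h1 => h3; apply: linked_trans h3 _; rewrite linked_sym.
  move=> yx yz; rewrite ltnNge; apply: contra h1 => xz.
  by rewrite linked_sym; apply: btw h2 (ltnW yx) xz.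
- move=> yx zy; have /negPf-> : ~~ linked A x z; last exact: ltn_trans yx.
  rewrite linked_sym; apply: contra h2 => h3.
  by rewrite linked_sym; apply: btw h3 (ltnW zy) (ltnW yx).
Qed.

Definition prec_rank x : 'I_m.+1 := inord #|[set y | prec y x]|.

Lemma prec_rankE x : prec_rank x = #|[set y | prec y x]| :> nat.
Proof.
have : #|[set y | prec y x]| < #|[set: 'I_m.+1]|.
  apply: proper_card; rewrite properE subsetT; apply/subsetPn.
  by exists x; rewrite ?inE ?prec_irr.
by rewrite cardsT card_ord => /inordK.
Qed.

Lemma prec_rank_lt x y : prec x y -> prec_rank x < prec_rank y.
Proof.
move=> xy; rewrite !prec_rankE; apply: proper_card.
apply/properP; split.
  by apply/subsetP => z; rewrite !inE => zx; apply: prec_trans zx xy.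
by exists x; rewrite inE ?prec_irr.
Qed.

Lemma prec_rank_inj : injective prec_rank.
Proof.
move=> x y xy; apply/eqP; apply: contraT => /prec_total/orP[] /prec_rank_lt;
by rewrite xy ltnn.
Qed.

(** Realizing the order [prec] by a permutation turns the placement condition on d into a
    distinguished-representative condition, which [card_DJ] can count. *)
Definition prec_perm : 'S_m.+1 := perm prec_rank_inj.

Lemma prec_permE x y : (prec_perm x < prec_perm y) = prec x y.
Proof.
rewrite !permE; apply/idP/idP => [h|]; last exact: prec_rank_lt.
have [xy|/prec_total/orP[//|/prec_rank_lt]] := eqVneq x y.
  by move: h; rewrite xy ltnn.
by move=> /(ltn_trans h); rewrite ltnn.
Qed.

End BlockOrder.

(** * Counting block placements by fixed cosets *)

Section BlockReps.

Variables (m : nat) (A J : seq nat).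
Hypotheses (mA : all (fun k => k < m) A) (mJ : all (fun k => k < m) J).
Implicit Types (x y : 'I_m.+1) (u w d : 'S_m.+1).

Definition block_maps : {set 'S_m.+1} :=
  [set y : 'S_m.+1 | all (fun i => linked J (y (inord i)) (y (inord i.+1))) A].

(** Along a block of J, the preimages under d must increase for [prec]. This one condition expresses
    both that each block of A is laid out consecutively in increasing order and that the blocks of A
    follow each other in decreasing order. *)
Lemma block_repsE :
  block_reps m A J = [set d in block_maps | DJ J (d^-1 * prec_perm m A)%g].
Proof.
apply/setP => d; rewrite !inE.
have DJE : DJ J (d^-1 * prec_perm m A)%g =
    all (fun j => prec A (d^-1%g (inord j)) (d^-1%g (inord j.+1))) J.
  by apply: eq_all => j; rewrite /asc !permM prec_permE.
apply/and3P/andP => [[Dd /allP sJ /allP AL]|[/allP dY DJd]].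
  split.
    apply/allP => i iA; have /mapP[j] := AL i iA.
    rewrite mem_filter => /andP[sj jJ] iE; have jm := allP mJ _ jJ.
    have [yE _ _ _] := DJ_linked jm Dd sj.
    have -> : inord i = d^-1%g (inord j) by rewrite iE inord_val.
    have -> : inord i.+1 = d^-1%g (inord j.+1) by rewrite iE -yE inord_val.
    by rewrite !permKV !inordK ?linkedS // ltnW.
  rewrite DJE; apply/allP => j jJ; have jm := allP mJ _ jJ.
  rewrite /prec; case: ifP => sj.
    by have [-> _ _ _] := DJ_linked jm Dd sj.
  have := sJ j jJ; rewrite /stays sj /= /asc -leqNgt leq_eqVlt.
  by rewrite eq_sym (negPf (perm_inord_neq _ (ltnSn j) jm)).
have mono x y : linked J x y -> x < y -> prec A (d^-1%g x) (d^-1%g y).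
  move=> xy lt_xy; have := DJ_mono DJd xy lt_xy.
  by rewrite !permM prec_permE.
have linkA i : i \in A -> linked A (inord i : 'I_m.+1) (inord i.+1 : 'I_m.+1).
  by move=> iA; have im := allP mA _ iA; rewrite !inordK ?linkedS // ltnW.
have Dd : DJ A d.
  apply/allP => i iA; have im := allP mA _ iA; rewrite /asc.
  have := perm_inord_neq d (ltnSn i) im; rewrite neq_ltn => /orP[//|lt].
  have := mono _ _ _ lt; rewrite linked_sym dY // => /(_ isT).
  by rewrite !permK /prec linked_sym linkA // !inordK //; lia.
split=> //.
  move: DJd; rewrite DJE => /allP DJd; apply/allP => j /DJd; rewrite /prec /stays.
  by case: ifP => //= _ h; rewrite /asc -leqNgt ltnW.
apply/allP => i iA; have im := allP mA _ iA.
set a := d (inord i); set b := d (inord i.+1).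
have ab : a < b := allP Dd _ iA.
have lab : linked J a b := dY i iA.
(* A position strictly between a and b would hold a point strictly between i and i+1 for [prec], and
   there is none. *)
have bE : b = a.+1 :> nat.
  apply/eqP; rewrite eqn_leq ab andbT leqNgt; apply/negP => lt2.
  have z1 : a.+1 < m.+1 := ltn_trans lt2 (ltn_ord b).
  pose z : 'I_m.+1 := Ordinal z1.
  have az : linked J a z by apply: linked_between lab _ _ => //=; lia.
  have zb : linked J z b by rewrite linked_sym in az; apply: linked_trans az lab.
  have := mono _ _ az (ltnSn a); have := mono _ _ zb lt2.
  rewrite /a /b !permK /prec.
  have := linkA i iA; move: (d^-1%g z) => c lA.
  have -> : linked A c (inord i.+1 : 'I_m.+1) = linked A (inord i : 'I_m.+1) c.
    apply/idP/idP => h.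
      by apply: linked_trans lA _; rewrite linked_sym.
    by rewrite linked_sym in h; apply: linked_trans h lA.
  have -> : (inord i.+1 : 'I_m.+1) = i.+1 :> nat by rewrite inordK.
  have -> : (inord i : 'I_m.+1) = i :> nat by rewrite inordK // ltnW.
  by case: ifP => _ h1 h2; clear -h1 h2; lia.
have aJ : val a \in J by rewrite -linkedS -bE.
apply/mapP; exists (val a); rewrite ?mem_filter ?aJ ?andbT.
  have a1 : inord a.+1 = b by rewrite -bE inord_val.
  by rewrite /stays inord_val a1 !permK linkA.
by rewrite inord_val permK /= inordK // ltnW.
Qed.

(** The substitution of d^-1 followed by [prec_perm] for d turns [block_maps] into a union of right
    cosets of [WJ m J], with [block_reps] as the distinguished elements. *)
Lemma card_block_reps :
  #|block_maps| = #|block_reps m A J| * #|WJ m J|.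
Proof.
pose f d := (d^-1 * prec_perm m A)%g.
have finj : injective f by move=> d d' /mulIg/invg_inj.
have -> : #|block_reps m A J| = #|[set z in f @: block_maps | DJ J z]|.
  rewrite block_repsE -(card_imset _ finj); apply: eq_card => z.
  rewrite [RHS]inE; apply/imsetP/andP => [[d /setIdP[dY Dd] ->]|[/imsetP[d dY ->] Dz]].
    by rewrite imset_f.
  by exists d => //; rewrite inE dY.
rewrite -card_DJ ?card_imset // => u z uJ /imsetP[d dY ->].
apply/imsetP; exists (d * u^-1)%g; last by rewrite /f invMg invgK mulgA.
move: dY; rewrite !inE => /allP dY; apply/allP => i iA.
have /WJP uJ' := groupVr uJ; rewrite !permM.
apply: linked_trans (uJ' _) _; rewrite linked_sym.
by apply: linked_trans (uJ' _) _; rewrite linked_sym dY.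
Qed.

Lemma sprod_sorted_val r i : sorted ltn r -> all (fun k => k < m) r -> i \in r ->
  sprod m r (inord i.+1) = inord i.
Proof.
elim: r => //= k r IHr; rewrite (path_sortedE ltn_trans) inE.
case/andP=> kr sr' /andP[km mr] /predU1P[->|ir]; rewrite sprod_cons permM.
  rewrite sref_r; have fix_k r' : all (ltn k) r' -> all (fun k => k < m) r' ->
      sprod m r' (inord k) = inord k.
    elim: r' => [|j r' IH] /=; first by rewrite /sprod big_nil perm1.
    case/andP=> kj kr' /andP[jm mr']; rewrite sprod_cons permM sref_inord_id ?IH //; clear -kj jm km; lia.
  exact: fix_k.
have ki := allP kr _ ir; have im := allP mr _ ir; rewrite /= in ki.
by rewrite sref_inord_id ?IHr //; clear -ki im; lia.
Qed.

(** The increasing product sends i+1 to i for each i in A, so its conjugate by y sends y(i+1) to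
    y(i); membership in [WJ m J] forces these to be linked. Conversely every conjugated letter is
    then a transposition inside a block. *)
Lemma conj_sprod_WJ (y : 'S_m.+1) : sorted ltn A -> (sprod m A ^ y \in WJ m J)%g = (y \in block_maps).
Proof.
move=> sA; rewrite [RHS]inE; apply/idP/allP => [/WJP h i iA|h].
  have := h (y (inord i.+1)); by rewrite permJ sprod_sorted_val.
elim: (A) h => [|i r IHr] h; first by rewrite /sprod big_nil conj1g group1.
rewrite sprod_cons conjMg groupM //; last first.
  by apply: IHr => j jr; apply: h; rewrite inE jr orbT.
by rewrite tpermJ tperm_WJ // h // mem_head.
Qed.

Lemma perm_char_block_reps la : sorted ltn A ->
  all (leq 1) la -> sumn la = m.+1 -> J = block_word 0 la ->
  perm_char_val la (sprod m A) = Posz #|block_reps m A J|.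
Proof.
move=> sA pos sumla JE; apply: (@intr_inj algC).
rewrite perm_char_valE parabolicE // -JE.
rewrite cfIndE ?subsetT //.
have -> : (\sum_(y in [set: 'S_m.+1]) (1 : 'CF(WJ_group m J))%CF (sprod m A ^ y)%g =
    #|block_maps|%:R :> algC)%R.
  rewrite -sum1_card natr_sum [RHS]big_mkcond /=; apply: eq_big => [y|y _].
    by rewrite inE.
  rewrite cfun1E conj_sprod_WJ //.
  by case: (y \in _).
rewrite card_block_reps natrM mulrC mulfK //.
by rewrite Num.Theory.pnatr_eq0 -lt0n cardG_gt0.
Qed.

End BlockReps.

(** * Compositions and cycle types *)

Section Compositions.

Implicit Types (be la : seq nat) (p : seq (nat * nat)).

Lemma mem_block_word off be k : k \in block_word off be -> off <= k.
Proof.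
elim: be off => //= a be IHbe off; rewrite mem_cat mem_iota.
by case/orP=> [/andP[]//|/IHbe]; apply: leq_trans; apply: leq_addr.
Qed.

Lemma block_word_lt off be k : all (leq 1) be -> k \in block_word off be ->
  k.+1 < off + sumn be.
Proof.
elim: be off => //= a be IHbe off /andP[a0 pos]; rewrite mem_cat mem_iota addnA.
by case/orP=> [|/(IHbe _ pos)//]; lia.
Qed.

Lemma block_word_sorted off be : sorted ltn (block_word off be).
Proof.
rewrite sorted_pairwise; last exact: ltn_trans.
elim: be off => //= a be IHbe off; rewrite pairwise_cat IHbe andbT.
rewrite -sorted_pairwise ?iota_ltn_sorted ?andbT; last exact: ltn_trans.
apply/allrelP => i j; rewrite mem_iota => /andP[_ hi] /mem_block_word hj.
by apply: leq_trans hj; rewrite (leq_trans hi) // leq_add2l leq_pred.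
Qed.

Lemma size_block_word off be : all (leq 1) be ->
  size (block_word off be) + size be = sumn be.
Proof.
elim: be off => //= a be IHbe off /andP[a0 pos].
by rewrite size_cat size_iota; have := IHbe (off + a) pos; lia.
Qed.

Lemma mem_comp_minus1 off be k : all (leq 1) be ->
  (k \in block_word off (comp_minus1 be)) =
  (k \in block_word off be) && (k.+1 \in block_word off be).
Proof.
elim: be off => // a be IHbe off /= /andP[a0 pos]; rewrite /comp_minus1 /=.
rewrite -/(comp_minus1 be); case: ltnP => a1 /=.
  have -> : off + a.-1 + 1 = off + a by lia.
  have hP := @mem_block_word (off + a) be k.
  have hQ := @mem_block_word (off + a) be k.+1.
  rewrite !mem_cat !mem_iota IHbe //; move: hP hQ.
  by case: (k \in _) => hP; case: (_ \in _) => hQ;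
    have := hP; have := hQ; lia.
have -> : a = 1 by lia.
exact: IHbe.
Qed.

(** A pair (a, l) stands for a block of size a named l; the result lists the block name of each
    point. Rearranging the blocks then becomes permuting a sequence. *)
Definition labels p : seq nat := flatten [seq nseq a.1 a.2 | a <- p].

Lemma size_labels p : size (labels p) = sumn (unzip1 p).
Proof. by elim: p => //= -[a l] p IHp; rewrite size_cat size_nseq IHp. Qed.

Lemma mem_labels p l : l \in labels p -> l \in unzip2 p.
Proof.
elim: p => //= -[a i] p IHp; rewrite mem_cat mem_nseq inE /= => /orP[|/IHp->].
  by case/andP=> _ ->.
by rewrite orbT.
Qed.

Lemma linked_shift off d U V x y :
  (forall k, off + d <= k -> (k \in U) = (k \in V)) ->
  linked U (off + (d + x)) (off + (d + y)) =
  linked V (off + d + x) (off + d + y).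
Proof.
move=> UV; rewrite !addnA; apply: eq_in_all => k; rewrite mem_iota => hk.
apply: UV; lia.
Qed.

Lemma linked_labels off p x y : all (leq 1) (unzip1 p) -> uniq (unzip2 p) ->
  x < sumn (unzip1 p) -> y < sumn (unzip1 p) ->
  linked (block_word off (unzip1 p)) (off + x) (off + y) =
  (nth 0 (labels p) x == nth 0 (labels p) y).
Proof.
elim: p off x y => // -[a l] p IHp off x y /= /andP[a0 pos] /andP[lp up] hx hy.
rewrite /labels /= !nth_cat !size_nseq !nth_nseq -/(labels p) /=.
have lab z : z < a + sumn (unzip1 p) -> a <= z -> nth 0 (labels p) (z - a) != l.
  move=> zs az; apply: contraNneq lp => <-; apply/mem_labels/mem_nth.
  rewrite size_labels; lia.
wlog xy : x y hx hy / x <= y.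
  move=> W; case: (leqP x y) => xy; first exact: W.
  by rewrite linked_sym eq_sym W // ltnW.
have aword : off + a.-1 \notin iota off a.-1 ++ block_word (off + a) (unzip1 p).
  rewrite mem_cat mem_iota negb_or; apply/andP; split; first lia.
  by apply/negP => /mem_block_word; lia.
case: (ltnP y a) => ya.
  rewrite (leq_ltn_trans xy ya) eqxx; apply/allP => k; rewrite mem_iota => hk.
  rewrite mem_cat mem_iota; apply/orP; left; lia.
case: (ltnP x a) => xa.
  rewrite eq_sym (negPf (lab y hy ya)); apply/negP => /linkedP/(_ _ aword); lia.
rewrite -{1}(subnKC xa) -{1}(subnKC ya) (@linked_shift off a _ (block_word (off + a) (unzip1 p))).
  by apply: IHp => //; lia.
move=> k hk; rewrite mem_cat mem_iota.
by have -> : off <= k < off + a.-1 = false by lia.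
Qed.

(** The bit at i tells whether i and i+1 share a block. Hence every set of simple reflections comes
    from a composition. *)
Fixpoint comp_of_bits (b : nat -> bool) off k : seq nat :=
  if k is k'.+1 then
    let c := comp_of_bits b off.+1 k' in
    if b off then (head 0 c).+1 :: behead c else 1 :: c
  else [:: 1].

Lemma comp_of_bitsP b off k :
  [/\ all (leq 1) (comp_of_bits b off k), comp_of_bits b off k != [::],
      sumn (comp_of_bits b off k) = k.+1 &
      block_word off (comp_of_bits b off k) = [seq i <- iota off k | b i]].
Proof.
elim: k off => [|k IHk] off /=; first by split; rewrite ?addn0.
have [] := IHk off.+1; case: (comp_of_bits b off.+1 k) => // a c /=.
case/andP=> a0 pos _ sumc wordc; case: (b off) => /=; split=> //.
- by rewrite addSn sumc.
- by rewrite -wordc addSnnS; case: (a) a0.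
- by rewrite a0.
- by rewrite sumc.
- by rewrite addn1 wordc.
Qed.

Lemma increasing_word_comp m J : increasing_word m J ->
  exists be, [/\ all (leq 1) be, sumn be = m.+1 & block_word 0 be = J].
Proof.
move=> /andP[sJ mJ]; exists (comp_of_bits (fun i => i \in J) 0 m).
have [pos _ sumb ->] := comp_of_bitsP (fun i => i \in J) 0 m; split=> //.
apply: (irr_sorted_eq ltn_trans ltnn) => //.
  by apply: sorted_filter; [exact: ltn_trans | exact: iota_ltn_sorted].
move=> i; rewrite mem_filter mem_iota andb_idr // => /(allP mJ).
by [].
Qed.


Definition block_labels be := zip be (iota 0 (size be)).

Lemma block_labels1 be : unzip1 (block_labels be) = be.
Proof. by rewrite unzip1_zip // size_iota. Qed.

Lemma block_labels_uniq be : uniq (unzip2 (block_labels be)).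
Proof. by rewrite unzip2_zip ?size_iota // iota_uniq. Qed.

Lemma perm_eq_linked m be la : all (leq 1) be -> sumn be = m.+1 ->
  perm_eq be la ->
  exists g : 'S_m.+1, forall x y : 'I_m.+1,
    linked (block_word 0 la) (g x) (g y) = linked (block_word 0 be) x y.
Proof.
move=> pos sumb eq_bl; pose q := block_labels la; pose p := block_labels be.
(* The rearrangement is lifted to named parts, so that equal parts are matched one to one; the
   sequences of names then differ by a permutation g of the points. *)
have [r rq rE] : exists2 r, perm_eq r q & unzip1 r = be.
  have : perm_eq be (unzip1 q) by rewrite block_labels1.
  move: (q) => q'; elim: (be) q' => [|a s IHs] q'.
    by move/perm_size; case: q' => // _; exists [::].
  move=> h; have /mapP[[a' l] alq /= aE] : a \in unzip1 q'.
    by rewrite -(perm_mem h) mem_head.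
  have hq := perm_to_rem alq.
  have [r hr rE] : exists2 r, perm_eq r (rem (a', l) q') & unzip1 r = s.
    apply: IHs; rewrite -(perm_cons a); apply: perm_trans h _.
    by rewrite aE; apply: (perm_map fst hq).
  exists ((a, l) :: r); last by rewrite /= rE.
  by rewrite perm_sym; apply: perm_trans hq _; rewrite aE perm_cons perm_sym.
have posl : all (leq 1) la by rewrite -(perm_all _ eq_bl).
have suml : sumn la = m.+1 by rewrite -sumb; apply/esym/perm_sumn.
have szq : size (labels q) == m.+1 by rewrite size_labels block_labels1 suml.
have szr : size (labels r) == m.+1 by rewrite size_labels rE sumb.
have /(@tuple_permP _ _ _ (Tuple szq))[g gE] : perm_eq (labels r) (labels q).
  by apply: perm_flatten; apply: perm_map.
have ur : uniq (unzip2 r).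
  by rewrite (perm_uniq (perm_map snd rq)) block_labels_uniq.
have nthE (x : 'I_m.+1) : nth 0 (labels r) x = nth 0 (labels q) (g x).
  rewrite gE -(tnth_nth 0 (mktuple _)) tnth_mktuple (tnth_nth 0).
  by [].
exists g => x y.
have := @linked_labels 0 q (g x) (g y); rewrite block_labels1 !add0n suml => -> //.
  have := @linked_labels 0 r x y; rewrite rE !add0n sumb => -> //.
  by rewrite !nthE.
exact: block_labels_uniq.
Qed.

Lemma count_labels p : uniq (unzip2 p) ->
  [seq count_mem l (labels p) | l <- unzip2 p] = unzip1 p.
Proof.
elim: p => //= -[a l] p IHp /= /andP[lp up].
rewrite /labels /= -/(labels p) count_cat count_nseq /= eqxx mul1n.
have -> : count_mem l (labels p) = 0.
  by apply/count_memPn; apply: contra lp; apply: mem_labels.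
rewrite addn0; congr (_ :: _); rewrite -[RHS](IHp up).
apply/eq_in_map => i ip; rewrite count_cat count_nseq /=.
by case: eqP => // li; move: lp; rewrite li ip.
Qed.

Lemma linkedW_porbit m J (x y : 'I_m.+1) : sorted ltn J ->
  all (fun k => k < m) J -> linked J x y -> x <= y -> x \in porbit (sprod m J) y.
Proof.
move=> sJ mJ; have [l] := ubnP (y - x); elim: l y => // l IHl y yx xy.
rewrite leq_eqVlt => /predU1P[/val_inj->|lt_xy]; first exact: porbit_id.
have y1 : y.-1 < m.+1 by rewrite (leq_ltn_trans (leq_pred _)).
have y1J : y.-1 \in J by move/allP: xy; apply; rewrite mem_iota; lia.
pose z : 'I_m.+1 := Ordinal y1.
have xz : x \in porbit (sprod m J) z.
  apply: IHl => /=; [lia| |lia].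
  by apply: linked_between xy _ _ => /=; lia.
have : sprod m J y = z.
  have -> : y = inord y.-1.+1 by rewrite prednK ?inord_val //; lia.
  rewrite sprod_sorted_val //; apply/val_inj; rewrite /= inordK //.
move=> yz; move: xz; rewrite -yz.
by have := porbit_perm (sprod m J) 1 y; rewrite expg1 => ->.
Qed.

Lemma porbit_linked m J (x y : 'I_m.+1) : sorted ltn J ->
  all (fun k => k < m) J -> (x \in porbit (sprod m J) y) = linked J x y.
Proof.
move=> sJ mJ; apply/idP/idP => [/porbitP[i ->]|xy].
  have : (sprod m J ^+ i)%g \in WJ m J by rewrite groupX // sprod_WJ.
  by move/WJP.
case: (leqP x y) => le; first exact: linkedW_porbit.
rewrite porbit_sym; apply: linkedW_porbit => //; last exact: ltnW.
by rewrite linked_sym.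
Qed.

(** The orbits of the Coxeter element are the blocks. The inverse appears because, by [tau_coef],
    pairing with T_w under tau reads the coefficient at w^-1. *)
Lemma cycle_type_sprod m be : all (leq 1) be -> sumn be = m.+1 ->
  cycle_type (sprod m (block_word 0 be))^-1%g = sort geq be.
Proof.
move=> pos sumb; rewrite /cycle_type porbitsV; set w := sprod m _.
pose p := block_labels be; have up : uniq (unzip2 p) := block_labels_uniq be.
have pE : unzip1 p = be := block_labels1 be.
have sJ := block_word_sorted 0 be.
have mJ : all (fun k => k < m) (block_word 0 be).
  by apply/allP => k /(block_word_lt pos); rewrite sumb.
pose lab (x : 'I_m.+1) := nth 0 (labels p) x.
pose C l := [set x | lab x == l].
have porbE y : porbit w y = C (lab y).
  apply/setP => x; rewrite inE porbit_linked //.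
  by have := @linked_labels 0 p x y; rewrite pE !add0n sumb => ->.
have szl : size (labels p) == m.+1 by rewrite size_labels pE sumb.
have labE x : lab x = tnth (Tuple szl) x by rewrite (tnth_nth 0).
have lab_in x : lab x \in unzip2 p.
  by apply: mem_labels; rewrite labE mem_tnth.
have cardC l : #|C l| = count_mem l (labels p).
  have <- : map (tnth (Tuple szl)) (enum 'I_m.+1) = labels p.
    exact: map_tnth_enum (Tuple szl).
  rewrite enumT cardsE cardE /enum_mem size_filter count_map.
  by apply: eq_count => x; rewrite /= [LHS]unfold_in /= -labE.
have C0 l : l \in unzip2 p -> exists x, lab x = l.
  move=> lp; have : l \in labels p.
    rewrite -has_pred1 has_count.
    have : count_mem l (labels p) \in be.
      by rewrite -pE -(count_labels up) (map_f (fun l => count_mem l (labels p))).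
    by move/(allP pos).
  by rewrite -[labels p]/(val (Tuple szl)) => /tnthP[x ->]; exists x; rewrite labE.
apply/perm_sortP.
- by move=> a b; apply: leq_total.
- by move=> a b c h1 h2; apply: leq_trans h1.
- by move=> a b; rewrite andbC -eqn_leq => /eqP.
rewrite -[X in perm_eq _ X]pE -(count_labels up).
have -> : [seq count_mem l (labels p) | l <- unzip2 p] =
    [seq #|pred_of_set c| | c <- [seq C l | l <- unzip2 p]].
  by rewrite -[RHS]map_comp; apply: eq_map => l; rewrite /= cardC.
apply: perm_map; apply: uniq_perm; first exact: enum_uniq.
  rewrite map_inj_in_uniq // => l l' /C0[x xl] _ /setP/(_ x).
  by rewrite !inE xl eqxx => /esym/eqP.
move=> c; rewrite mem_enum; apply/imsetP/mapP => [[x _ ->]|[l /C0[x xl] ->]].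
  by exists (lab x); rewrite ?porbE.
by exists x; rewrite // porbE xl.
Qed.

(** Each transposition changes the number of cycles by at most one. This is the lower bound on
    length within a conjugacy class. *)
Lemma card_porbits_sprod m r : m.+1 <= #|porbits (sprod m r)| + size r.
Proof.
elim: r => [|k r IHr].
  rewrite addn0 /sprod big_nil /porbits card_imset ?card_ord // => x y.
  move/setP/(_ x); rewrite porbit_id => /esym/porbitP[i ->].
  by rewrite expg1n perm1.
have le : #|porbits (sprod m r)| <= #|porbits (sprod m (k :: r))|.+1.
  rewrite sprod_cons /sref; set x := inord k; set y := inord k.+1.
  have [->|xy] := eqVneq x y; first by rewrite tperm1 mul1g.
  have := porbits_mul_tperm (sprod m r) x y; rewrite xy /= => h.
  by rewrite -(leq_add2r 1) -h addSnnS leq_add2l; case: (x \notin _).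
by rewrite /= addnS -addSn; apply: leq_trans IHr _; rewrite leq_add2r.
Qed.

Lemma porbits_conj m (s y : 'S_m.+1) : #|porbits (s ^ y)%g| = #|porbits s|.
Proof.
have <- : [set (y @: (c : {set 'I_m.+1})) | c in porbits s] = porbits (s ^ y)%g.
  have porbE x : y @: porbit s x = porbit (s ^ y)%g (y x).
    apply/setP => z; apply/imsetP/porbitP => [[_ /porbitP[i ->] ->]|[i ->]].
      by exists i; rewrite -conjXg permJ.
    by exists ((s ^+ i)%g x); [apply: mem_porbit | rewrite -conjXg permJ].
  apply/setP => c; apply/imsetP/imsetP => [[_ /imsetP[x _ ->] ->]|[x _ ->]].
    by exists (y x).
  exists (porbit s (y^-1%g x)); first exact: imset_f.
  by rewrite porbE permKV.
by rewrite card_imset //; apply: imset_inj; apply: perm_inj.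
Qed.

End Compositions.

(** * The expansion *)

(** A descent at k of the product of the remaining letters would put k among them, so each new
    letter is an ascent. *)
Lemma redw_sprod m r : uniq r -> all (fun k => k < m) r -> redw (sprod m r) r.
Proof.
elim: r => [_ _|k r IHr]; first by rewrite /redw /word eqxx /sprod big_nil inv1.
move=> /= /andP[kr ur] /andP[km mr]; have red := IHr ur mr.
apply: redw_cons => //; last by rewrite sprod_cons mulKsr.
rewrite sprod_cons asc_sref // negbK; apply: contraR kr.
by apply: WJ_desc => //; apply: sprod_WJ.
Qed.

(** * Coxeter elements of compositions and their minimality *)

Section WordsOfCompositions.

Variables (m : nat) (be : seq nat).
Hypotheses (pos : all (leq 1) be) (sumb : sumn be = m.+1).

Lemma block_word_bound : all (fun k => k < m) (block_word 0 be).
Proof. by apply/allP => k /(block_word_lt pos); rewrite sumb. Qed.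

Lemma block_word_uniq : uniq (block_word 0 be).
Proof. exact: sorted_uniq ltn_trans ltnn _ (block_word_sorted 0 be). Qed.

Lemma w_compE : w_comp m.+1 be = sprod m (block_word 0 be).
Proof.
rewrite /w_comp -(comp_wordE pos sumb) /sprod big_map.
by apply: eq_bigr => i _; apply: srefl_sref.
Qed.

Lemma ninv_sprod_block_word : ninv (sprod m (block_word 0 be)) = size (block_word 0 be).
Proof.
by have /andP[_ /eqP] := redw_sprod block_word_uniq block_word_bound.
Qed.

Lemma l_compE : l_comp m.+1 be = size (block_word 0 be).
Proof. by rewrite /l_comp len_inv w_compE ninv_sprod_block_word. Qed.

Lemma min_in_class_sprod : min_in_class (sprod m (block_word 0 be))^-1%g.
Proof.
set w := (_^-1)%g; apply/forall_inP => _ /imsetP[y _ ->].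
rewrite !len_inv /w inv_invg ninv_sprod_block_word.
have [r /andP[_ /eqP rE] <-] := inv_word_exists (w ^ y)%g.
have := card_porbits_sprod m r; rewrite rE porbits_conj.
have -> : #|porbits w| = size be.
  have := congr1 size (cycle_type_sprod pos sumb).
  by rewrite /cycle_type !size_sort size_map -cardE.
by rewrite -sumb -(size_block_word 0 pos) addnC leq_add2l.
Qed.

Lemma comp_minus1_pos : all (leq 1) (comp_minus1 be).
Proof.
elim: (be) pos => //= a s IHs /andP[a0 /IHs h]; rewrite /comp_minus1 /= all_cat.
by rewrite -/(comp_minus1 s) h andbT; case: ltnP => /= a1; rewrite ?a0 ?andbT // ltn_predRL.
Qed.

Lemma sumn_comp_minus1 : sumn (comp_minus1 be) = m.+1.
Proof.
rewrite -sumb; elim: (be) pos => //= a s IHs /andP[a0 /IHs <-].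
rewrite /comp_minus1 /= sumn_cat -/(comp_minus1 s); congr (_ + _).
by case: ltnP => /= a1; rewrite ?addn0 // addn1 prednK.
Qed.

End WordsOfCompositions.

(** A permutation of the points carrying the blocks of [be] to those of [la] matches both
    [block_maps] and the parabolic subgroups, and [block_reps] is counted by their quotient. *)
Lemma card_block_reps_perm m A be la : all (fun k => k < m) A ->
  all (leq 1) be -> sumn be = m.+1 -> perm_eq be la ->
  #|block_reps m A (block_word 0 be)| = #|block_reps m A (block_word 0 la)|.
Proof.
move=> mA pos sumb eq_bl; have [g gE] := perm_eq_linked pos sumb eq_bl.
have posl : all (leq 1) la by rewrite -(perm_all _ eq_bl).
have suml : sumn la = m.+1 by rewrite -sumb; apply/esym/perm_sumn.
have mapsE : #|block_maps m A (block_word 0 be)| = #|block_maps m A (block_word 0 la)|.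
  rewrite -(card_imset _ (mulIg g)); apply: eq_card => y.
  apply/imsetP/idP => [[z]|].
    rewrite !inE => /allP h ->; apply/allP => i /h.
    by rewrite !permM gE.
  rewrite inE => /allP h; exists (y * g^-1)%g; last by rewrite mulgKV.
  by rewrite inE; apply/allP => i /h; rewrite -gE -!permM mulgKV.
have WE : #|WJ m (block_word 0 be)| = #|WJ m (block_word 0 la)|.
  rewrite -(card_imset _ (conjg_inj g)); apply: eq_card => u.
  apply/imsetP/idP => [[v /WJP h ->]|/WJP h].
    by apply/WJP => x; rewrite -(permKV g x) permJ gE.
  exists (u ^ g^-1)%g; last by rewrite conjgKV.
  by apply/WJP => x; rewrite -gE -permJ conjgKV.
apply/eqP; rewrite -(eqn_pmul2r (cardG_gt0 (WJ_group m (block_word 0 be)))) /=.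
rewrite -card_block_reps ?block_word_bound // mapsE WE.
by rewrite -card_block_reps ?block_word_bound.
Qed.

Lemma parts_inj n : injective (@parts n).
Proof. by move=> a b /(inj_map val_inj)/val_inj/val_inj. Qed.

Lemma parts_partition n (la : intpart n) :
  all (leq 1) la /\ sumn la = n.
Proof. by case: la => v h; have /and3P[h1 /eqP h2 _] := h. Qed.

Section Main.

Local Open Scope ring_scope.

Variables (m : nat) (H : algType {poly int}) (t : 'I_m -> H).
Hypothesis hH : @is_hecke_algebra m.+1 H t.

Let Ht : @hecke_relations m.+1 H t := hecke_rel hH.

Local Notation Ts := (Ts t).
Local Notation TT := (TT t).
Local Notation Tprod := (Tprod t).

Lemma eta_JMprodE (al : seq nat) : all (leq 1) al -> sumn al = m.+1 ->
  @Defs.eta m.+1 H t al = JMprod t (block_word 0 al) m.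
Proof.
move=> pos suma; rewrite /Defs.eta /rel_norm dist_reps1 w_compE //.
rewrite (parabolicE (comp_minus1_pos pos) (sumn_comp_minus1 pos suma)).
rewrite -/(TT _) -eta_JMprod //.
rewrite /= (@eq_WJ m (block_word 0 (comp_minus1 al))
                    (drop_ends (block_word 0 al) m)); last first.
  move=> k; rewrite mem_comp_minus1 // mem_filter mem_iota [RHS]andb_idr //.
  by case/andP=> _ /(allP (block_word_bound pos suma)) /=; lia.
have -> : [seq i <- iota 0 m | i \in block_word 0 al] = block_word 0 al.
  apply: (irr_sorted_eq ltn_trans ltnn); last first.
  - move=> k; rewrite mem_filter mem_iota andb_idr // => /(allP (block_word_bound pos suma)).
    by [].
  - exact: block_word_sorted.
  by apply: sorted_filter; [exact: ltn_trans | exact: iota_ltn_sorted].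
apply: eq_bigr => u _.
by rewrite -(TTE Ht (redw_sprod (block_word_uniq al) (block_word_bound pos suma))).
Qed.

Lemma norm_basisE (al : seq nat) : all (leq 1) al -> sumn al = m.+1 ->
  @norm_basis m.+1 H t al = \sum_(d | DJ (block_word 0 al) d)
    TT d^-1%g * JMprod t (block_word 0 al) m * TT d.
Proof.
move=> pos suma; rewrite /norm_basis /rel_norm eta_JMprodE // parabolicE //.
rewrite dist_repsE ?block_word_bound //.
by apply: eq_bigl => d; rewrite inE.
Qed.

Theorem norm_basis_succ (Gamma : intpart m.+1 -> H)
    (hGamma : forall la : intpart m.+1, @is_class_element m.+1 H t la (Gamma la))
    (al : intpart m.+1) :
  @norm_basis m.+1 H t al =
  \sum_(la : intpart m.+1)
    (if (l_comp m.+1 al <= l_comp m.+1 la)%N then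
       ((perm_char_val la (w_comp m.+1 al))%:~R
          * 'X^(l_comp m.+1 la - l_comp m.+1 al)) *: Gamma la
     else 0).
Proof.
have [tau tauT] := trace_form_exists Ht hH.
have [pos suma] := parts_partition al.
have mA := block_word_bound pos suma.
pose A := block_word 0 al.
pose cf (la : intpart m.+1) : {poly int} :=
  if (size A <= size (block_word 0 la))%N then
    #|block_reps m A (block_word 0 la)|%:R * 'X^(size (block_word 0 la) - size A)
  else 0.
transitivity (\sum_(la : intpart m.+1) cf la *: Gamma la); last first.
  apply: eq_bigr => la _; have [posl suml] := parts_partition la.
  rewrite /cf !l_compE // w_compE // -/A; case: ifP => // _; last by rewrite scale0r.
  by rewrite (perm_char_block_reps mA (block_word_bound posl suml)
    (block_word_sorted 0 al) posl suml erefl).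
rewrite norm_basisE // -/A; apply/eqP; rewrite -subr_eq0; apply/eqP.
have gG la : gen t m (Gamma la).
  have [_ [c [-> _ _]]] := hGamma la.
  by apply: gen_sum => w _; apply: hgenZ; apply: (gen_TT Ht).
apply: (central_eq0 Ht tauT).
- apply: hgenB; apply: gen_sum => *; last exact: hgenZ.
  by do !apply: hgenM; try exact: (gen_TT Ht); apply: gen_JMprod.
- move=> k km; rewrite mulrBr mulrBl norm_comm //; last first.
    move=> j jA; apply: JMprod_low => //; exact: (allP mA).
  congr (_ - _); rewrite mulr_sumr mulr_suml; apply: eq_bigr => la _.
  by rewrite -scalerAr -scalerAl; have [-> _] := hGamma la.
move=> J incJ; have [be [posb sumb JE]] := increasing_word_comp incJ.
pose w := (sprod m J)^-1%g.
(* Sorting [be] gives the partition l0 of the one class element with nonzero trace against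
   [Tprod J]. *)
have partb : is_partition m.+1 (sort geq be).
  apply/and3P; split; first by rewrite all_sort.
    by rewrite (perm_sumn (permEl (perm_sort _ _))) sumb.
  by apply: sort_sorted => a b; apply: leq_total.
have [l0 l0E] := intpart_surj partb.
have tpJ : Tprod J = TT w^-1%g.
  rewrite invgK (TTE Ht (r := J)) //; case/andP: incJ => sJ mJ.
  by apply: redw_sprod => //; apply: sorted_uniq sJ; [exact: ltn_trans|exact: ltnn].
have tG la : tau (Gamma la * Tprod J) = (la == l0)%:R.
  have [_ [c [-> _ hc]]] := hGamma la; rewrite tpJ (tau_coef Ht tauT).
  have minw : min_in_class w by rewrite /w -JE; apply: min_in_class_sprod.
  have := hc w minw => /eqP; rewrite subr_eq0 => /eqP ->.
  rewrite inE /w -JE cycle_type_sprod // -l0E.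
  by rewrite (inj_eq (@parts_inj _)) eq_sym.
rewrite mulrBl linearB /= tau_norm ?block_word_uniq // mulr_suml linear_sum /=.
rewrite (bigD1 l0) //= big1 ?addr0 => [|la /negPf nl]; last first.
  by rewrite -scalerAl linearZ /= tG nl mulr0.
rewrite -scalerAl linearZ /= tG eqxx mulr1 /cf -/A -JE.
have eq_bl : perm_eq be l0 by rewrite l0E perm_sym (permEl (perm_sort _ _)).
rewrite (card_block_reps_perm mA posb sumb eq_bl).
have -> : size (block_word 0 l0) = size (block_word 0 be).
  have [pos0 sum0] := parts_partition l0.
  apply/eqP; rewrite -(eqn_add2r (size be)) (size_block_word 0 posb) sumb.
  by rewrite (perm_size eq_bl) (size_block_word 0 pos0) sum0.
by rewrite subrr.
Qed.

End Main.

Local Open Scope ring_scope.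

Theorem theorem9p2 (n : nat) (n_gt0 : (0 < n)%N)
    (H : algType {poly int}) (t : 'I_n.-1 -> H) (hH : is_hecke_algebra t)
    (Gamma : intpart n -> H)
    (hGamma : forall la : intpart n, is_class_element t la (Gamma la))
    (al : intpart n) :
  norm_basis t al =
  \sum_(la : intpart n)
    (if (l_comp n al <= l_comp n la)%N then
       ((perm_char_val la (w_comp n al))%:~R
          * 'X^(l_comp n la - l_comp n al)) *: Gamma la
     else 0).
Proof.
case: n n_gt0 t hH Gamma hGamma al => // m _ t hH Gamma hGamma al.
exact: norm_basis_succ.
Qed.
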